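(* Let $K$ be a finite set with $|K|\ge2$, let $u\in\mathcal U^*$ and let $(u_n)$ be a sequence in $\mathcal U^*$. Then $(u_n)$ converges to $u$ for the value-based distance, i.e. $d(u_n,u)\to0$, if and only if the sequence $(\tilde u_n)$ converges weakly to $\tilde u$ in $\Pi_0$.
   Context: An information structure is a probability $u\in\Delta(K\times\mathbb N\times\mathbb N)$ on triples $(k,c,d)$; $k$ is the state, $c$ the signal of player 1 (maximizer), $d$ the signal of player 2 (minimizer). $\mathcal U$ is the set of information structures. A payoff function is a map $g:K\times I\times J\to[-1,1]$ with $I,J$ finite nonempty sets; $\mathcal G$ is the set of all payoff functions. $\mathrm{val}(u,g)$ is the value of the zero-sum Bayesian game in which $(k,c,d)\sim u$, player 1 learns $c$, player 2 learns $d$, they simultaneously choose $i\in I$, $j\in J$ (mixed actions depending on own signal allowed), and player 1 receives $g(k,i,j)$ from player 2. $d(u,v)=\sup_{g\in\mathcal G}|\mathrm{val}(u,g)-\mathrm{val}(v,g)|$. Write $u\sim v$ if $\mathrm{val}(u,g)=\mathrm{val}(v,g)$ for all $g\in\mathcal G$, and $\mathcal U^*=\mathcal U/\!\sim$; $d$ is a metric on $\mathcal U^*$. Belief hierarchies: let $T^1=\Delta(K)$ and $T^{n+1}=\Delta(K\times T^1\times\cdots\times T^n)$, each endowed with the weak topology (compact metrizable). Given $u\in\mathcal U$, a signal $c$ of positive probability induces the first-order belief $b_1^1(c)\in T^1$, the conditional law of $k$ given $c$, and similarly $b_2^1(d)$ for player 2; inductively $b_1^{n+1}(c)\in T^{n+1}$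 is the conditional law of $(k,b_2^1(d),\dots,b_2^n(d))$ given $c$, and symmetrically for player 2. The Mertens–Zamir hierarchy of $c$ is $\tilde c=(b_1^n(c))_{n\ge1}\in\Theta_1$, that of $d$ is $\tilde d=(b_2^n(d))_{n\ge1}\in\Theta_2$, where $\Theta_i\subset\prod_n T^n$ is the (compact) set of coherent hierarchies of player $i$, with the product topology. $\tilde u\in\Delta(K\times\Theta_1\times\Theta_2)$ is the law of $(k,\tilde c,\tilde d)$ when $(k,c,d)\sim u$; it depends only on the class of $u$ in $\mathcal U^*$. $\Pi_0=\{\tilde u:u\in\mathcal U\}$, with the weak topology. *)

(* Defs.v *)
From HB Require Import structures.
From mathcomp Require Import all_boot all_order all_algebra.
From mathcomp Require Import all_classical all_reals all_analysis.

Set Implicit Arguments.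
Unset Strict Implicit.
Unset Printing Implicit Defensive.
Import Order.TTheory GRing.Theory Num.Theory.
Import numFieldNormedType.Exports.
Local Open Scope classical_set_scope.
Local Open Scope ring_scope.

(* MathComp-Analysis measurable types are pointed; [1 < #|K|] supplies the
   point, so it is made a parameter of the state type. *)
Definition state (K : finType) (hK : (1 < #|K|)%N) : Type := K.

Section State.
Variables (K : finType) (hK : (1 < #|K|)%N).
HB.instance Definition _ := Finite.copy (state hK) K.
HB.instance Definition _ :=
  isPointed.Build (state hK) (enum_val (Ordinal (ltnW hK)) : K).
HB.instance Definition _ := @isMeasurable.Build default_measure_display
  (state hK) discrete_measurable discrete_measurable0
  discrete_measurableC discrete_measurableU.
HB.instance Definition _ := hasNbhs.Build (state hK) principal_filter.
HB.instance Definition _ := Discrete_ofNbhs.Build (state hK) erefl.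
End State.

(* A triple (k, c, d) is parsed as ((k, c), d). *)
Notation triple hK := (state hK * nat * nat)%type.

Definition info (R : realType) (K : finType) (hK : (1 < #|K|)%N) : Type :=
  probability (triple hK) R.

Section Value.
Context {R : realType} {K : finType} {hK : (1 < #|K|)%N}.

Definition strategy (A : finType) : set (nat -> A -> R) :=
  [set s | forall c, (forall a, 0 <= s c a) /\ \sum_a s c a = 1].

Definition payoff (I J : finType) (u : info R hK) (g : K -> I -> J -> R)
    (s : nat -> I -> R) (t : nat -> J -> R) : R :=
  \int[u]_w (\sum_i \sum_j s w.1.2 i * t w.2 j * g w.1.1 i j).

(* By the minimax theorem this is also the infimum over [t] of the supremum
   over [s]. *)
Definition game_val (I J : finType) (u : info R hK) (g : K -> I -> J -> R) : R :=
  sup [set inf [set payoff u g s t | t in @strategy J] | s in @strategy I].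

(* The supremum is over a nonempty set of reals bounded by 2. [vdist] is a
   metric on classes of information structures with the same values; here it
   is evaluated on representatives. *)
Definition vdist (u v : info R hK) : R :=
  sup [set r | exists (I J : finType) (g : K -> I -> J -> R),
    [/\ (0 < #|I|)%N, (0 < #|J|)%N, (forall k i j, -1 <= g k i j <= 1)
      & r = `|game_val u g - game_val v g|]].

End Value.

HB.instance Definition _ (X Y : ptopologicalType) := Pointed.on (X * Y)%type.

Definition borel (X : ptopologicalType) : Type := g_sigma_algebraType (@open X).
HB.instance Definition _ (X : ptopologicalType) :=
  Measurable.copy (borel X) (g_sigma_algebraType (@open X)).

Section Delta.
Variables (R : realType) (X : ptopologicalType).

(* A [probability] is a function on all sets; requiring it to vanish on the
   non-measurable ones makes equality in [Delta] the equality of measures. *)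
Definition off_borel0 : set (probability (borel X) R) :=
  [set mu | forall A : set (borel X), ~ measurable A -> mu A = 0%E].

Definition Delta : Type := set_type off_borel0.

Definition bounded_continuous : set (X -> R) :=
  [set f | continuous f /\ exists M : R, forall x, `|f x| <= M].

(* The weak topology: the coarsest making all expectations of bounded
   continuous functions continuous. *)
Definition expectations (mu : Delta) : {ptws bounded_continuous -> R} :=
  fun f => \int[\val mu]_x (\val f x).

HB.instance Definition _ := Choice.on Delta.
HB.instance Definition _ :=
  Topological.copy Delta (initial_topology expectations).

Section Restrict.
Variable mu : probability (borel X) R.
Local Open Scope ereal_scope.

Definition on_borel (A : set (borel X)) : \bar R :=
  if pselect (measurable A) then mu A else 0.

Let on_borel_meas A : measurable A -> on_borel A = mu A.
Proof. by move=> mA; rewrite /on_borel; case: pselect. Qed.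

Let on_borel0 : on_borel set0 = 0.
Proof. by rewrite on_borel_meas. Qed.

Let on_borel_ge0 A : 0 <= on_borel A.
Proof. by rewrite /on_borel; case: pselect => // ?; exact: measure_ge0. Qed.

Let on_borel_sigma_additive : semi_sigma_additive on_borel.
Proof.
move=> F mF tF mUF; rewrite on_borel_meas//.
rewrite (_ : (fun n => _) = fun n => \sum_(0 <= i < n) mu (F i)); last first.
  by apply/funext => n; apply: eq_bigr => i _; rewrite on_borel_meas.
exact: measure_semi_sigma_additive.
Qed.

HB.instance Definition _ := isMeasure.Build _ _ _ on_borel
  on_borel0 on_borel_ge0 on_borel_sigma_additive.

Let on_borel1 : on_borel setT = 1.
Proof. by rewrite on_borel_meas// probability_setT. Qed.

HB.instance Definition _ :=
  Measure_isProbability.Build _ _ _ on_borel on_borel1.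

Lemma on_borel_off0 : ([the probability _ _ of on_borel]) \in off_borel0.
Proof. by apply/mem_set => A /= nA; rewrite /on_borel; case: pselect. Qed.

Definition to_Delta : Delta := exist (fun x => x \in off_borel0) _ on_borel_off0.

Lemma to_DeltaE A : measurable A -> \val to_Delta A = mu A.
Proof. exact: on_borel_meas. Qed.

End Restrict.

HB.instance Definition _ := isPointed.Build Delta
  (to_Delta (dirac (point : borel X))).

End Delta.

Section Law.
Context {R : realType} {K : finType} {hK : (1 < #|K|)%N}.

Lemma triple_measurable (A : set (triple hK)) : measurable A.
Proof.
apply: countable_measurable; last exact: countableP.
move=> [[k c] d].
have -> : [set (k, c, d)] = [set k] `*` [set c] `*` [set d].
  by apply/seteqP; split=> [w ->|[[x y] z] [[/= -> ->] ->]].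
by apply: measurableX => //; apply: measurableX.
Qed.

Section Def.
Variables (X : ptopologicalType) (f : triple hK -> X).

Lemma triple_measurable_fun :
  measurable_fun setT (f : triple hK -> borel X).
Proof. by move=> _ A _; exact: triple_measurable. Qed.

Definition law (P : probability (triple hK) R) : Delta R X :=
  to_Delta (distribution P (mfun_Sub (mem_set triple_measurable_fun))).

Lemma lawE (P : probability (triple hK) R) (A : set (borel X)) :
  measurable A -> \val (law P) A = P (f @^-1` A).
Proof. exact: to_DeltaE. Qed.
End Def.
End Law.

Lemma borel_setXT (X Y : ptopologicalType) (A : set (borel X)) :
  measurable A -> measurable (A `*` setT : set (borel (X * Y)%type)).
Proof.
move=> mA.
have mfst : measurable_fun setT (fst : borel (X * Y)%type -> borel X).
  apply: (@measurability _ _ (borel (X * Y)%type) (borel X) _ _ (@open X)) => //.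
  move=> _ [B oB <-]; rewrite setTI; apply: sub_sigma_algebra.
  by apply: open_comp oB => x _; exact: cvg_fst.
have -> : A `*` setT = setT `&` fst @^-1` A :> set (borel (X * Y)%type).
  by apply/seteqP; split=> [w []|w []].
exact: mfst.
Qed.

Section Hierarchies.
Variables (R : realType) (K : finType) (hK : (1 < #|K|)%N).

(* [level n] is K x T^1 x ... x T^n and [Delta R (level n)] is T^{n+1}. *)
Fixpoint level (n : nat) : ptopologicalType :=
  match n with
  | 0 => state hK
  | n'.+1 => (level n' * Delta R (level n'))%type
  end.

(* The component of index [n] is the belief of order n + 1. *)
Definition beliefs : Type := prod_topology (fun n => Delta R (level n)).
HB.instance Definition _ := Topological.on beliefs.

(* The marginal of the belief of order n + 2 on K x T^1 x ... x T^n is the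
   belief of order n + 1. Both players' hierarchies live in the same space. *)
Definition coherent : set beliefs :=
  [set h : beliefs | forall n (A : set (borel (level n))), measurable A ->
    \val (h n.+1) (A `*` setT) = \val (h n) A].

Definition Theta : Type := set_type coherent.
HB.instance Definition _ := Topological.on Theta.

Lemma coherent_point : (fun n => point : Delta R (level n)) \in coherent.
Proof.
apply/mem_set => n A mA.
rewrite [LHS]to_DeltaE; last exact: borel_setXT.
rewrite [RHS]to_DeltaE//.
have E : ((point : level n.+1) \in A `*` setT) = ((point : level n) \in A).
  by apply/idP/idP; rewrite !inE; [case|].
exact: (congr1 (fun b : bool => b%:R%:E) E).
Qed.

HB.instance Definition _ := isPointed.Build Theta
  (exist (fun x => x \in coherent) _ coherent_point).

Section Beliefs.
Variable u : info R hK.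

(* Players are booleans: [true] is player 1, and [~~ i] is the opponent of
   [i]. *)
Definition signal (i : bool) (w : triple hK) : nat := if i then w.1.2 else w.2.

(* The law of (k, c, d) given that player [i] has signal [c]; it is [u], an
   irrelevant default, if [c] has probability zero. *)
Definition cond (i : bool) (c : nat) : probability (triple hK) R :=
  mnormalize (mrestr u (triple_measurable (signal i @^-1` [set c]))) u.

(* [view n i (k, c, d)] is (k, b_i^1, ..., b_i^n), where the beliefs b_i^m
   are those of player [i]. *)
Fixpoint view (n : nat) (i : bool) (w : triple hK) : level n :=
  match n return level n with
  | 0 => w.1.1
  | n'.+1 => (view n' i w, law (view n' (~~ i)) (cond i (signal i w)))
  end.

Definition belief (i : bool) (c n : nat) : Delta R (level n) :=
  law (view n (~~ i)) (cond i c).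

Lemma belief_coherent i c : (belief i c : beliefs) \in coherent.
Proof.
apply/mem_set => n A mA; rewrite lawE; last exact: borel_setXT.
by rewrite lawE//; congr (cond _ _ _); apply/seteqP; split=> [w []|w].
Qed.

Definition hierarchy (i : bool) (c : nat) : Theta :=
  exist (fun x => x \in coherent) _ (belief_coherent i c).

(* The law of the state and of the two Mertens-Zamir hierarchies. *)
Definition mz : Delta R (state hK * Theta * Theta)%type :=
  law (fun w => (w.1.1 : state hK,
                 hierarchy true w.1.2, hierarchy false w.2)) u.

End Beliefs.
End Hierarchies.

(* Main.v *)
(** Both convergences are equivalent to convergence of the expectations of all
    "statistics": the functions of the state and of the hierarchies obtained
    from functions of the state by lattice operations and by taking a player's
    conditional expectation of a statistic of the opponent.

    - Values control statistics: a conditional expectation [Y = E[h | signal]]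
      can be elicited in a finite game by letting the player announce a real
      number [y] on a grid and charging him [M (y - h)^2] with [M] large. This
      changes the value by [M E (Y - h)^2] up to an error [O(1/M)], uniformly in
      the information structure, and [E (Y - h)^2] is itself such a value, so
      conditional expectations can be eliminated one at a time.
    - Statistics control the weak topology: along statistics, the views of each
      order converge at every signal of the limit [u], by induction on the
      order. As [u] is carried by countably many points, a bounded continuous
      function is minorized by a maximum of finitely many bump statistics whose
      expectation under [u] is almost the same. No compactness is needed.
    - Conversely, statistics are bounded continuous functions of the state and
      of the hierarchies.
    - Statistics control values: fix finitely many classes of signals of [u]
      carrying almost all the mass, and bump statistics around them. A strategy
      in [u] is carried to [u_n] by mixing its class averages with the bumps as
      weights; a reply in [u_n] is carried back to [u] by averaging it against
      the bumps of the opponent. The bumps are chosen so small that the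
      opponent's beliefs about the first player's bumps are nearly constant on
      them, hence both payoffs are nearly the same expression, in which only
      the expectations of the bumps differ. *)
Require Import Defs.
From HB Require Import structures.
From mathcomp Require Import all_boot all_order all_algebra.
From mathcomp Require Import all_classical all_reals all_analysis.
From mathcomp Require Import measurable_realfun.
From mathcomp Require Import ring lra.
Import Order.TTheory GRing.Theory Num.Theory.
Import numFieldNormedType.Exports.
Set Implicit Arguments.
Unset Strict Implicit.
Unset Printing Implicit Defensive.
Local Open Scope classical_set_scope.
Local Open Scope ring_scope.

(** * Expectation and conditioning *)

(** The multiplicative form covers null events [A] as well: both sides are then zero, whatever
    measure [mnormalize] falls back to. *)
Lemma fine_mnormalize_mrestr d (T : measurableType d) (R : realType)
    (P : probability T R) (A B : set T) (mA : measurable A) : measurable B ->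
  fine (P (B `&` A)) = fine (P A) * fine (mnormalize (mrestr P mA) P B).
Proof.
move=> mB; rewrite /mnormalize /= /mrestr setTI.
have PA : (P A < +oo)%E by rewrite (le_lt_trans (probability_le1 P mA))// ltry.
have PBA : (P (B `&` A) <= P A)%E.
  by apply: le_measure; rewrite ?inE//; exact: measurableI.
have [PA0|PA0] := eqVneq (P A) 0%E.
  move: PBA; rewrite PA0 => h.
  have /eqP -> : (P (B `&` A) == 0)%E by rewrite eq_le h measure_ge0.
  by rewrite mul0r.
rewrite (lt_eqF PA) /=.
have fA : P A \is a fin_num by rewrite ge0_fin_numE.
rewrite -[in RHS](@fineK _ (P (B `&` A))).
  by rewrite -EFinM /= mulrCA divff ?mulr1// fine_eq0.
by rewrite ge0_fin_numE//; exact: le_lt_trans PA.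
Qed.

Section Expectation.
Context {R : realType} {K : finType} {hK : (1 < #|K|)%N}.
Implicit Types (P : info R hK) (f g : triple hK -> R).

Definition Ex P f : R := \int[P]_w f w.

Definition bounded f := exists B : R, forall w, `|f w| <= B.

Lemma bounded_cst c : bounded (fun=> c).
Proof. by exists `|c|. Qed.

Lemma boundedD f g : bounded f -> bounded g -> bounded (fun w => f w + g w).
Proof.
by move=> [B hB] [C hC]; exists (B + C) => w; rewrite (le_trans (ler_normD _ _))// lerD.
Qed.

Lemma boundedM f g : bounded f -> bounded g -> bounded (fun w => f w * g w).
Proof.
by move=> [B hB] [C hC]; exists (B * C) => w; rewrite normrM ler_pM.
Qed.

Lemma boundedN f : bounded f -> bounded (fun w => - f w).
Proof. by move=> [B hB]; exists B => w; rewrite normrN. Qed.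

Lemma boundedB f g : bounded f -> bounded g -> bounded (fun w => f w - g w).
Proof. by move=> bf bg; apply: boundedD => //; exact: boundedN. Qed.

Lemma bounded_sum (I : Type) (r : seq I) (D : pred I) (F : I -> triple hK -> R) :
  (forall i, bounded (F i)) -> bounded (fun w => \sum_(i <- r | D i) F i w).
Proof.
move=> bF; elim: r => [|i r [B hB]].
  by exists 0 => w; rewrite big_nil normr0.
have [C hC] := bF i; exists (`|C| + B) => w; rewrite big_cons.
case: ifP => _.
  by rewrite (le_trans (ler_normD _ _))// lerD// (le_trans (hC w))// ler_norm.
by apply: le_trans (hB w) _; rewrite lerDr.
Qed.

Lemma triple_measurable_real f : measurable_fun setT f.
Proof. by move=> _ A _; exact: triple_measurable. Qed.

Lemma bounded_integrable P f : bounded f -> P.-integrable setT (EFin \o f).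
Proof.
move=> [B hB]; apply: measurable_bounded_integrable => //.
- by rewrite [X in (X < _)%E]probability_setT ltry.
- exact: triple_measurable_real.
- by exists B; split; [exact: num_real|move=> C BC w _; apply: le_trans (hB w) (ltW BC)].
Qed.

Lemma Ex_cst P c : Ex P (fun=> c) = c.
Proof.
by rewrite /Ex Rintegral_cst// [X in fine X]probability_setT mulr1.
Qed.

Lemma ExD P f g : bounded f -> bounded g ->
  Ex P (fun w => f w + g w) = Ex P f + Ex P g.
Proof. by move=> bf bg; rewrite /Ex RintegralD//; exact: bounded_integrable. Qed.

Lemma ExB P f g : bounded f -> bounded g ->
  Ex P (fun w => f w - g w) = Ex P f - Ex P g.
Proof. by move=> bf bg; rewrite /Ex RintegralB//; exact: bounded_integrable. Qed.

Lemma ExZ P f c : bounded f -> Ex P (fun w => c * f w) = c * Ex P f.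
Proof. by move=> bf; rewrite /Ex RintegralZl//; exact: bounded_integrable. Qed.

Lemma eq_Ex P f g : f =1 g -> Ex P f = Ex P g.
Proof. by move=> fg; apply: eq_Rintegral => w _; exact: fg. Qed.

Lemma Ex_le P f g : bounded f -> bounded g -> (forall w, f w <= g w) ->
  Ex P f <= Ex P g.
Proof.
by move=> bf bg fg; rewrite /Ex le_Rintegral//; exact: bounded_integrable.
Qed.

Lemma Ex_ge0 P f : (forall w, 0 <= f w) -> 0 <= Ex P f.
Proof. by move=> f0; apply: Rintegral_ge0 => w _; exact: f0. Qed.

Lemma Ex_sum P (I : Type) (r : seq I) (D : pred I) (F : I -> triple hK -> R) :
  (forall i, bounded (F i)) ->
  Ex P (fun w => \sum_(i <- r | D i) F i w) = \sum_(i <- r | D i) Ex P (F i).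
Proof.
move=> bF; elim: r => [|i r IH].
  by rewrite big_nil -[RHS](Ex_cst P 0); apply: eq_Ex => w; rewrite big_nil.
rewrite big_cons; under eq_Ex do rewrite big_cons.
by case: ifP => _ //; rewrite ExD// ?IH//; exact: bounded_sum.
Qed.

Lemma Ex_norm_le P f g : bounded f -> bounded g -> (forall w, `|f w| <= g w) ->
  `|Ex P f| <= Ex P g.
Proof.
move=> bf bg fg; rewrite ler_norml -mulN1r -ExZ//.
apply/andP; split; apply: Ex_le => //.
- by apply: boundedM => //; exact: bounded_cst.
- by move=> w; rewrite mulN1r; have := fg w; rewrite ler_norml => /andP[].
- by move=> w; rewrite (le_trans (ler_norm _)).
Qed.

Lemma Ex_norm_bound P f B : (forall w, `|f w| <= B) -> `|Ex P f| <= B.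
Proof.
move=> fB; rewrite -[leRHS](Ex_cst P); apply: Ex_norm_le => //.
  by exists B.
exact: bounded_cst.
Qed.

Definition ind (A : set (triple hK)) : triple hK -> R := \1_A.

Lemma indE A w : ind A w = (w \in A)%:R. Proof. by rewrite /ind indicE. Qed.

Lemma ind_ge0 A w : 0 <= ind A w. Proof. by rewrite indE. Qed.

Lemma ind_le1 A w : ind A w <= 1. Proof. by rewrite indE lern1 leq_b1. Qed.

Lemma bounded_ind A : bounded (ind A).
Proof. by exists 1 => w; rewrite ger0_norm ?ind_ge0// ind_le1. Qed.

Lemma Ex_ind P A : Ex P (ind A) = fine (P A).
Proof.
rewrite /Ex /Rintegral integral_indic// ?setIT//; exact: triple_measurable.
Qed.

(** These sets are finite, and every probability on triples gives almost all its mass to one of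
    them. *)
Definition box N : set (triple hK) := [set w | (pickle w < N)%N].

Lemma box_cvg P : Ex P (ind (~` box N)) @[N --> \oo] --> (0 : R).
Proof.
have -> : (fun N => Ex P (ind (~` box N))) = (fun N => 1 - fine (P (box N))).
  apply/funext => N; rewrite -Ex_ind -[X in X - _](Ex_cst P) -ExB; first last.
  - exact: bounded_ind.
  - exact: bounded_cst.
  by apply: eq_Ex => w; rewrite !indE in_setC; case: (_ \in _); rewrite ?subrr ?subr0.
rewrite -[X in _ --> X](subrr 1); apply: cvgB; first exact: cvg_cst.
have h : P (box N) @[N --> \oo] --> (1%:E : \bar R).
  have bT : \bigcup_n box n = setT.
    by apply/seteqP; split=> // w _; exists (pickle w).+1; rewrite //= /box /=.
  rewrite -(probability_setT P) -bT; apply: nondecreasing_cvg_mu.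
  - by move=> n; exact: triple_measurable.
  - exact: triple_measurable.
  - by move=> m n mn; apply/subsetPset => w /= /leq_trans; exact.
exact: (fine_cvg h).
Qed.

Lemma box_eventually P (e : R) : 0 < e -> \forall N \near \oo, Ex P (ind (~` box N)) <= e.
Proof.
move=> e0; have /cvgrPdist_le/(_ e e0) := box_cvg P; apply: filterS => N.
by rewrite sub0r normrN ger0_norm// Ex_ge0// => w; exact: ind_ge0.
Qed.

(** [pickle_inv] is partial: a code of no triple contributes zero. *)
Lemma ind_box N w : ind (box N) w =
  \sum_(m < N) oapp (fun w' => ind [set w'] w) 0 (pickle_inv (val m)).
Proof.
have tm (m : 'I_N) : oapp (fun w' => ind [set w'] w) 0 (pickle_inv (val m)) =
    (val m == pickle w)%:R.
  have [->|mw] := eqVneq (val m) (pickle w).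
    by rewrite pickleK_inv /= indE mem_set.
  case E : (pickle_inv (val m)) => [w'|//] /=.
  rewrite indE memNset//= => ww'; move: mw; rewrite ww'.
  by have := @pickle_invK (triple hK) (val m); rewrite E /= => ->; rewrite eqxx.
rewrite (eq_bigr _ (fun m _ => tm m)) indE.
have [wN|wN] := ltnP (pickle w) N.
  rewrite mem_set// (bigD1 (Ordinal wN))//= eqxx big1 ?addr0// => m /negPf mN.
  by case: eqVneq => // mw; move: mN; rewrite -(inj_eq val_inj) /= mw eqxx.
rewrite memNset/=; last by rewrite /box/= ltnNge wN.
rewrite big1// => m _; case: eqVneq => // mw.
by have := ltn_ord m; rewrite [X in (X < _)%N]mw ltnNge wN.
Qed.

(** The remainder is at most a bound of [f] times the mass outside a [box]. Identities between
    expectations can thus be checked atom by atom. *)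
Lemma Ex_cvg_mass P f : bounded f ->
  \sum_(m < N) oapp (fun w => f w * fine (P [set w])) 0 (pickle_inv (val m))
    @[N --> \oo] --> Ex P f.
Proof.
move=> bf.
have -> : (fun N => \sum_(m < N) oapp (fun w => f w * fine (P [set w])) 0
    (pickle_inv (val m))) = fun N => Ex P f - Ex P (fun w => f w * ind (~` box N) w).
  apply/funext => N; rewrite -ExB//; last first.
    by apply: boundedM => //; exact: bounded_ind.
  have -> : (fun w => f w - f w * ind (~` box N) w) = fun w => \sum_(m < N)
      oapp (fun w' => f w' * ind [set w'] w) 0 (pickle_inv (val m)).
    apply/funext => w.
    have -> : f w - f w * ind (~` box N) w = f w * ind (box N) w.
      by rewrite !indE in_setC; case: (_ \in _) => /=; lra.
    rewrite ind_box mulr_sumr; apply: eq_bigr => m _.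
    case: (pickle_inv _) => [w'|]/=; last by rewrite mulr0.
    rewrite !indE; have [|ww'] := boolP (w \in [set w']); last by rewrite !mulr0.
    by rewrite inE => ->.
  rewrite Ex_sum; last first.
    move=> m; case: (pickle_inv _) => [w'|]/=; last exact: bounded_cst.
    by apply: boundedM; [exact: bounded_cst|exact: bounded_ind].
  apply: eq_bigr => m _; case: (pickle_inv _) => [w'|]/=; last by rewrite Ex_cst.
  by rewrite ExZ ?Ex_ind//; exact: bounded_ind.
rewrite -[X in _ --> X]subr0; apply: cvgB; first exact: cvg_cst.
have [B hB] := bf.
have cB : `|B| * Ex P (ind (~` box N)) @[N --> \oo] --> (0 : R).
  rewrite -[X in _ --> X](mulr0 `|B|); apply: cvgM; [exact: cvg_cst|exact: box_cvg].
apply/norm_cvg0P; apply: (squeeze_cvgr _ (cvg_cst 0) cB).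
apply: nearW => N; rewrite normr_ge0 /= -ExZ; last exact: bounded_ind.
apply: Ex_norm_le.
- by apply: boundedM => //; exact: bounded_ind.
- by apply: boundedM; [exact: bounded_cst|exact: bounded_ind].
- move=> w; rewrite normrM (ger0_norm (ind_ge0 _ _)) ler_wpM2r ?ind_ge0//.
  by rewrite (le_trans (hB w))// ler_norm.
Qed.

(* [cond u i] is [cond_at u (signal i)]. *)
Definition cond_at P (s : triple hK -> nat) (c : nat) : info R hK :=
  mnormalize (mrestr P (triple_measurable (s @^-1` [set c]))) P.

(** Both sides are sums over atoms that agree term by term by [fine_mnormalize_mrestr]; the factor
    in front keeps the identity true for null events. *)
Lemma Ex_cond_at P s c f : bounded f ->
  Ex P (fun w => ind (s @^-1` [set c]) w * f w) =
  Ex P (ind (s @^-1` [set c])) * Ex (cond_at P s c) f.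
Proof.
move=> bf; set A := s @^-1` [set c].
have bA : bounded (fun w => ind A w * f w) by apply: boundedM => //; exact: bounded_ind.
have h1 := @Ex_cvg_mass P _ bA.
have h2 := @Ex_cvg_mass (cond_at P s c) _ bf.
apply: (cvg_unique _ h1) => //.
rewrite (_ : (fun N => _) = fun N => Ex P (ind A) * \sum_(m < N)
  oapp (fun w => f w * fine (cond_at P s c [set w])) 0 (pickle_inv (val m))).
  by apply: cvgM => //; exact: cvg_cst.
apply/funext => N; rewrite mulr_sumr; apply: eq_bigr => m _.
case: (pickle_inv _) => [w|]/=; last by rewrite mulr0.
suff h : ind A w * fine (P [set w]) = Ex P (ind A) * fine (cond_at P s c [set w]).
  by rewrite mulrAC h; ring.
have e := @fine_mnormalize_mrestr _ _ _ P A _ (triple_measurable A)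
  (triple_measurable [set w]).
rewrite Ex_ind; transitivity (fine (P ([set w] `&` A))); last exact: e.
rewrite indE.
have [wA|wA] := boolP (w \in A).
  rewrite (_ : [set w] `&` A = [set w]) ?mul1r//.
  by apply/seteqP; split=> [x []//|x ->]; split=> //; exact: set_mem.
rewrite (_ : [set w] `&` A = set0) ?measure0 ?mul0r//.
by apply/seteqP; split=> // x [-> /mem_set]; exact/negP.
Qed.

(** A version of E[f | s] defined at every triple; at values of [s] of probability zero it is the
    unconditional expectation. *)
Definition condE P s f w : R := Ex (cond_at P s (s w)) f.

Lemma bounded_condE P s f : bounded f -> bounded (condE P s f).
Proof. by move=> [B hB]; exists B => w; exact: Ex_norm_bound. Qed.

(** A finite box carries almost all the mass, and [s] is bounded on it. *)
Lemma nat_tail P (s : triple hK -> nat) (e : R) : 0 < e ->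
  exists N, Ex P (ind [set w | (N <= s w)%N]) <= e.
Proof.
move=> e0; have [N _ /(_ N (leqnn _)) hN] := box_eventually P e0.
have [M hM] : exists M, forall w, (pickle w < N)%N -> (s w < M)%N.
  exists (\max_(m < N) oapp s 0%N (pickle_inv (val m))).+1 => w wN.
  rewrite ltnS; apply: leq_trans (leq_bigmax (Ordinal wN)).
  by rewrite /= pickleK_inv.
exists M; apply: le_trans hN; apply: Ex_le; [exact: bounded_ind..|] => w.
rewrite !indE in_setC ler_nat.
have [wN|wN] := boolP (w \in box N); last by rewrite leq_b1.
by rewrite memNset//= => Ms; move: wN; rewrite inE => /hM; rewrite ltnNge Ms.
Qed.

(* Truncating the conditioning variable at N reduces the countable sum over
   its values to a finite one. *)
Lemma tower P s f (q : nat -> R) : bounded f -> (exists B : R, forall c, `|q c| <= B) ->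
  Ex P (fun w => q (s w) * f w) = Ex P (fun w => q (s w) * condE P s f w).
Proof.
move=> bf [B hB]; have bc := bounded_condE P s bf.
have bq : bounded (fun w => q (s w)) by exists B.
have bd : bounded (fun w => f w - condE P s f w) by exact: boundedB.
apply/eqP; rewrite -subr_eq0 -ExB; try exact: boundedM.
have -> : (fun w => q (s w) * f w - q (s w) * condE P s f w) =
  (fun w => q (s w) * (f w - condE P s f w)) by apply/funext => w; ring.
set g := fun w => q (s w) * _.
have bg : bounded g by exact: boundedM.
(* On a level set of [s], both [q] and the conditional expectation are constant, so [g] integrates
   to zero there. *)
have z c : Ex P (fun w => ind (s @^-1` [set c]) w * g w) = 0.
  have -> : (fun w => ind (s @^-1` [set c]) w * g w) = fun w =>
      q c * (ind (s @^-1` [set c]) w * f w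
             - Ex (cond_at P s c) f * ind (s @^-1` [set c]) w).
    apply/funext => w; rewrite /g /condE !indE.
    have [|_] := boolP (w \in s @^-1` [set c]); last by rewrite /=; ring.
    by rewrite inE => /= ->; ring.
  have b1 : bounded (fun w => ind (s @^-1` [set c]) w * f w).
    by apply: boundedM => //; exact: bounded_ind.
  have b2 : bounded (fun w => Ex (cond_at P s c) f * ind (s @^-1` [set c]) w).
    by apply: boundedM; [exact: bounded_cst|exact: bounded_ind].
  rewrite ExZ; last exact: boundedB.
  by rewrite ExB// Ex_cond_at// ExZ; [ring|exact: bounded_ind].
have [C hC] := bg.
(* The level sets below [N] contribute nothing, so only the tail of [s] remains. *)
have tail N : `|Ex P g| <= `|C| * Ex P (ind [set w | (N <= s w)%N]).
  have -> : Ex P g = Ex P (fun w => ind [set w | (N <= s w)%N] w * g w).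
    have bi (i : 'I_N) : bounded (fun w => ind (s @^-1` [set val i]) w * g w).
      by apply: boundedM => //; exact: bounded_ind.
    have s0 : \sum_(i < N) Ex P (fun w => ind (s @^-1` [set val i]) w * g w) = 0.
      by rewrite big1.
    rewrite -[LHS]subr0 -s0 -Ex_sum//.
    rewrite -ExB//; last exact: bounded_sum.
    apply: eq_Ex => w; rewrite -mulr_suml -[X in X - _]mul1r -mulrBl; congr (_ * _).
    rewrite indE; have [wN|wN] := leqP N (s w).
      rewrite mem_set// big1 ?subr0// => i _; rewrite indE memNset//= => si.
      by have := ltn_ord i; rewrite -[X in (X < _)%N]si ltnNge wN.
    rewrite (bigD1 (Ordinal wN))//= indE mem_set// big1; last first.
      move=> i iN; rewrite indE memNset//= => si; move/eqP: iN; apply.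
      exact: val_inj.
    by rewrite memNset/=; [rewrite addr0 subrr|rewrite leqNgt wN].
  rewrite -ExZ; last exact: bounded_ind.
  apply: Ex_norm_le.
  - by apply: boundedM => //; exact: bounded_ind.
  - by apply: boundedM; [exact: bounded_cst|exact: bounded_ind].
  - move=> w; rewrite normrM (ger0_norm (ind_ge0 _ _)) mulrC ler_wpM2r ?ind_ge0//.
    by rewrite (le_trans (hC w))// ler_norm.
rewrite -normr_le0; apply/ler_addgt0Pl => e e0; rewrite addr0.
have e1 : 0 < e / (`|C| + 1) by rewrite divr_gt0// ltr_wpDl.
have [M hM] := nat_tail P s e1.
apply: le_trans (tail M) _.
apply: (@le_trans _ _ (`|C| * (e / (`|C| + 1)))); first by rewrite ler_wpM2l.
rewrite mulrCA -[leRHS]mulr1; apply: ler_wpM2l; first exact: ltW.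
by rewrite ler_pdivrMr ?ltr_wpDl// mul1r lerDl.
Qed.

End Expectation.

(** * Elicitation of beliefs in games *)

Section Values.
Context {R : realType}.

Definition dist (A : finType) (p : A -> R) :=
  (forall a, 0 <= p a) /\ \sum_a p a = 1.

Lemma norm_sum_le (A : finType) (p x : A -> R) B :
  (forall a, 0 <= p a) -> (forall a, `|x a| <= B) ->
  `|\sum_a p a * x a| <= (\sum_a p a) * B.
Proof.
move=> p0 xB; rewrite mulr_suml; apply: le_trans (ler_norm_sum _ _ _) _.
by apply: ler_sum => a _; rewrite normrM (ger0_norm (p0 a)) ler_wpM2l.
Qed.

Lemma dist_norm_le (A : finType) (p x : A -> R) B :
  dist p -> (forall a, `|x a| <= B) -> `|\sum_a p a * x a| <= B.
Proof. by move=> [p0 p1] xB; rewrite -[leRHS]mul1r -p1; exact: norm_sum_le. Qed.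

Lemma dist_point (A : finType) (a0 : A) : dist (fun a => (a == a0)%:R).
Proof.
split=> [a|]; first exact: ler0n.
by rewrite (bigD1 a0)//= eqxx big1 ?addr0// => a /negPf ->.
Qed.

Lemma dist_le1 (A : finType) (p : A -> R) a : dist p -> p a <= 1.
Proof.
by move=> [p0 <-]; rewrite (bigD1 a)//= lerDl sumr_ge0.
Qed.

Definition maxmin (S T : Type) (D : set S) (E : set T) (F : S -> T -> R) : R :=
  sup [set inf [set F s t | t in E] | s in D].

(** The maximizer's strategies are carried forward and the minimizer's replies are carried back. The
    bounds make every supremum and infimum genuine; the factor [C] serves to rescale payoffs. *)
Lemma maxmin_le (S T S' T' : Type) (D : set S) (E : set T) (D' : set S')
    (E' : set T') (F : S -> T -> R) (F' : S' -> T' -> R) (B C e : R) :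
  D !=set0 -> E !=set0 -> E' !=set0 -> 0 < C ->
  (forall s t, D s -> E t -> `|F s t| <= B) ->
  (forall s t, D' s -> E' t -> `|F' s t| <= B) ->
  (forall s, D s -> exists2 s', D' s' & forall t', E' t' ->
    exists2 t, E t & C * F s t - e <= F' s' t') ->
  C * maxmin D E F - e <= maxmin D' E' F'.
Proof.
move=> [s0 Ds0] [t0 Et0] [t1 Et1] C0 FB FB' h.
rewrite lerBlDr mulrC -ler_pdivlMr//.
apply: ge_sup; first by exists (inf [set F s0 t | t in E]), s0.
move=> _ [s Ds <-]; rewrite ler_pdivlMr// mulrC -lerBlDr.
have [s' Ds' hs'] := h s Ds.
apply: (@le_trans _ _ (inf [set F' s' t | t in E'])); last first.
  apply: ub_le_sup; last by exists s'.
  exists B => _ [r Dr <-]; apply: (@le_trans _ _ (F' r t1)).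
    apply: ge_inf; last by exists t1.
    by exists (- B) => _ [t Et <-]; have := FB' r t Dr Et; rewrite ler_norml => /andP[].
  by rewrite (le_trans (ler_norm _))// FB'.
apply: lb_le_inf; first by exists (F' s' t1), t1.
move=> _ [t' Et' <-]; have [t Et ht] := hs' t' Et'.
apply: le_trans ht; rewrite lerD2r ler_pM2l//; apply: ge_inf; last by exists t.
by exists (- B) => _ [r Er <-]; have := FB s r Ds Er; rewrite ler_norml => /andP[].
Qed.

Lemma sup_norm_le (D : set R) B : D !=set0 -> (forall x, D x -> `|x| <= B) -> `|sup D| <= B.
Proof.
move=> [x Dx] DB; rewrite ler_norml; apply/andP; split; last first.
  by apply: ge_sup; [exists x|move=> y /DB; exact/le_trans/ler_norm].
apply: (@le_trans _ _ x); first by have := DB x Dx; rewrite ler_norml => /andP[].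
by apply: ub_le_sup => //; exists B => y /DB; exact/le_trans/ler_norm.
Qed.

Lemma maxmin_norm_le (S T : Type) (D : set S) (E : set T) (F : S -> T -> R) B :
  D !=set0 -> E !=set0 -> (forall s t, D s -> E t -> `|F s t| <= B) ->
  `|maxmin D E F| <= B.
Proof.
move=> [s Ds] [t Et] FB; apply: sup_norm_le; first by exists (inf [set F s t | t in E]), s.
move=> _ [s' Ds' <-]; rewrite /inf normrN; apply: sup_norm_le.
  by exists (- F s' t), (F s' t) => //; exists t.
by move=> _ [_ [t' Et' <-] <-]; rewrite normrN FB.
Qed.

Lemma maxmin_cst (S T : Type) (D : set S) (E : set T) (F : S -> T -> R) c :
  D !=set0 -> E !=set0 -> (forall s t, D s -> E t -> F s t = c) -> maxmin D E F = c.
Proof.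
move=> [s Ds] [t Et] Fc; rewrite /maxmin.
have -> : [set inf [set F s t | t in E] | s in D] = [set c]; last exact: sup1.
have e s' : D s' -> inf [set F s' t | t in E] = c.
  move=> Ds'; have -> : [set F s' t | t in E] = [set c]; last exact: inf1.
  by apply/seteqP; split=> [_ [t' Et' <-]|_ ->]; [exact: Fc|exists t => //; exact: Fc].
by apply/seteqP; split=> [_ [s' Ds' <-]|_ ->]; [exact: e|exists s => //; exact: e].
Qed.

End Values.

Section BayesianGames.
Context {R : realType} {K : finType} {hK : (1 < #|K|)%N}.
Implicit Types (P : info R hK).

Lemma strategy_nonempty (A : finType) : (0 < #|A|)%N ->
  (@strategy R A) !=set0.
Proof.
by move=> /card_gt0P[a0 _]; exists (fun _ a => (a == a0)%:R) => c; exact: dist_point.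
Qed.

Definition mean P (i : bool) (A : finType) (s : nat -> A -> R)
    (X : triple hK -> A -> R) : R :=
  Ex P (fun w => \sum_a s (signal i w) a * X w a).

Definition bilin (A B : finType) (Z : triple hK -> A -> B -> R)
    (s : nat -> A -> R) (t : nat -> B -> R) (w : triple hK) : R :=
  \sum_a \sum_b s w.1.2 a * t w.2 b * Z w a b.

Definition gpay P (A B : finType) (Z : triple hK -> A -> B -> R)
    (s : nat -> A -> R) (t : nat -> B -> R) : R := Ex P (bilin Z s t).

(** The payoff [Z] may depend on the whole triple, so that conditional expectations can enter it;
    values of actual games are the case where it depends on the state only. *)
Definition gval P (A B : finType) (Z : triple hK -> A -> B -> R) : R :=
  maxmin (@strategy R A) (@strategy R B) (gpay P Z).

Lemma game_valE P (A B : finType) (g : K -> A -> B -> R) :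
  game_val P g = gval P (fun w => g w.1.1).
Proof. by []. Qed.

Lemma gpay_mean1 P (A B : finType) (Z : triple hK -> A -> B -> R) s t :
  gpay P Z s t = mean P true s (fun w a => \sum_b t w.2 b * Z w a b).
Proof.
apply: eq_Ex => w; rewrite /bilin /=; apply: eq_bigr => a _; rewrite mulr_sumr.
by apply: eq_bigr => b _; rewrite mulrA.
Qed.

Lemma gpay_mean2 P (A B : finType) (Z : triple hK -> A -> B -> R) s t :
  gpay P Z s t = mean P false t (fun w b => \sum_a s w.1.2 a * Z w a b).
Proof.
apply: eq_Ex => w; rewrite /bilin /= exchange_big; apply: eq_bigr => b _.
by rewrite mulr_sumr; apply: eq_bigr => a _; rewrite mulrCA mulrA.
Qed.

Lemma bilin_norm_le (A B : finType) (Z : triple hK -> A -> B -> R) s t w C :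
  strategy s -> strategy t -> (forall a b, `|Z w a b| <= C) -> `|bilin Z s t w| <= C.
Proof.
move=> hs ht hZ; rewrite /bilin.
under eq_bigr do (under eq_bigr do rewrite -mulrA; rewrite -mulr_sumr).
apply: dist_norm_le => // a; apply: dist_norm_le => //; exact: ht.
Qed.

Lemma gpay_norm_le P (A B : finType) (Z : triple hK -> A -> B -> R) s t C :
  strategy s -> strategy t -> (forall w a b, `|Z w a b| <= C) -> `|gpay P Z s t| <= C.
Proof. by move=> hs ht hZ; apply: Ex_norm_bound => w; exact: bilin_norm_le. Qed.

(** * Announcing a conditional expectation under a quadratic score *)

Section Announcement.
Variables (P : info R hK) (i : bool) (h : triple hK -> R) (Bh : R).
Hypothesis hB : forall w, `|h w| <= Bh.
Let Y := condE P (signal i) h.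
Variables (A G : finType) (y : G -> R) (By : R).
Hypothesis yB : forall m, `|y m| <= By.
Variable M : R.
Hypothesis M0 : 0 < M.

Definition tame (B L : R) (Psi : triple hK -> A -> R -> R) :=
  [/\ forall w a r, `|Psi w a r| <= B, 0 <= L &
      forall w a r r', `|Psi w a r - Psi w a r'| <= L * `|r - r'|].

(** This is a cost: the announcing player minimizes it. The maximizer is treated by changing the
    sign of [Psi]. *)
Definition scored (Psi : triple hK -> A -> R -> R) (w : triple hK) (am : A * G) : R :=
  Psi w am.1 (y am.2) + M * (y am.2 - h w) ^+ 2.

Let YB w : `|Y w| <= Bh. Proof. exact: Ex_norm_bound. Qed.
Let bh : bounded h. Proof. by exists Bh. Qed.
Let bY : bounded Y. Proof. by exists Bh. Qed.

(** The error [Y - h] is orthogonal to every bounded function of the signal. This removes the cross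
    term when the score is expanded around [Y]. *)
Let ortho (q : nat -> R) (C : R) : (forall c, `|q c| <= C) ->
  Ex P (fun w => q (signal i w) * (Y w - h w)) = 0.
Proof.
move=> qC; have bq : bounded (fun w => q (signal i w)) by exists C.
have e := tower P (signal i) bh (ex_intro _ C qC).
under eq_Ex do rewrite mulrBr.
by rewrite ExB; [rewrite e subrr|exact: boundedM|exact: boundedM].
Qed.

Let Yc c : R := Ex (cond_at P (signal i) c) h.

Let V := Ex P (fun w => (Y w - h w) ^+ 2).

Let bV : bounded (fun w => (Y w - h w) ^+ 2).
Proof. by apply: boundedM; exact: boundedB. Qed.

Let score_le w m : `|M * (y m - h w) ^+ 2| <= M * (By + Bh) ^+ 2.
Proof.
rewrite normrM (gtr0_norm M0) ler_pM2l// normrX.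
have yh : `|y m - h w| <= By + Bh by rewrite (le_trans (ler_normB _ _))// lerD.
by rewrite ler_pXn2r ?nnegrE// (le_trans _ yh).
Qed.

(** Announcing a grid point within [eta] of the true belief costs [L * eta] through [Psi] and
    [M * eta ^+ 2] through the score. The strategy is found before [Psi], so one strategy serves
    against all strategies of the opponent. *)
Lemma scored_truthful (eta : R) (s : nat -> A -> R) :
  strategy s -> 0 <= eta -> (forall r, `|r| <= Bh -> exists m, `|y m - r| <= eta) ->
  exists2 s' : nat -> A * G -> R, strategy s' & forall B L Psi, tame B L Psi ->
    mean P i s' (scored Psi) <=
    mean P i s (fun w a => Psi w a (Y w)) + M * V + (L * eta + M * eta ^+ 2).
Proof.
move=> hs eta0 grid.
have /choice[pt hpt] : forall c, exists m, `|y m - Yc c| <= eta.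
  by move=> c; apply: grid; exact: Ex_norm_bound.
have sumpt w (F : A * G -> R) : \sum_am (s (signal i w) am.1 *
    (am.2 == pt (signal i w))%:R) * F am =
    \sum_a s (signal i w) a * F (a, pt (signal i w)).
  transitivity (\sum_a \sum_m (s (signal i w) a * (m == pt (signal i w))%:R) * F (a, m)).
    by rewrite pair_bigA; apply: eq_bigr => -[a m].
  apply: eq_bigr => a _; rewrite (bigD1 (pt (signal i w)))//= eqxx mulr1.
  by rewrite big1 ?addr0// => m /negPf ->; rewrite mulr0 mul0r.
exists (fun c am => s c am.1 * (am.2 == pt c)%:R).
  move=> c; have [s0 s1] := hs c; split=> [am|]; first by rewrite mulr_ge0// ler0n.
  transitivity (\sum_a \sum_m (s c a * (m == pt c)%:R)).
    by rewrite pair_bigA.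
  rewrite -[RHS]s1; apply: eq_bigr => a _.
  rewrite -mulr_sumr -[RHS]mulr1; congr (_ * _).
  by have [] := @dist_point R _ (pt c).
move=> BPsi L Psi [PsiB L0 PsiL].
pose q c := 2 * M * (y (pt c) - Yc c).
have qB c : `|q c| <= `|2 * M| * eta by rewrite normrM ler_wpM2l.
have bq : bounded (fun w => q (signal i w) * (Y w - h w)).
  by apply: boundedM; [exists (`|2 * M| * eta)|exact: boundedB].
have bPsi : bounded (fun w => \sum_a s (signal i w) a * Psi w a (Y w)).
  by exists BPsi => w; exact: dist_norm_le.
(* A null expectation given by [ortho] is added, so that the inequality can be checked pointwise. *)
rewrite -[M * V]addr0 -[X in M * V + X](ortho qB) /mean -/Y -ExZ// -ExD//; last first.
  by apply: boundedM => //; exact: bounded_cst.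
have b3 : bounded (fun w => M * (Y w - h w) ^+ 2 + q (signal i w) * (Y w - h w)).
  by apply: boundedD => //; apply: boundedM => //; exact: bounded_cst.
rewrite -ExD// -[X in _ + X](Ex_cst P) -ExD//; [|exact: boundedD|exact: bounded_cst].
apply: Ex_le.
- under eq_fun do rewrite sumpt.
  exists (BPsi + M * (By + Bh) ^+ 2) => w; apply: dist_norm_le => // a.
  by rewrite (le_trans (ler_normD _ _))// lerD// score_le.
- by apply: boundedD; [exact: boundedD|exact: bounded_cst].
move=> w; rewrite sumpt /scored /=.
under eq_bigr do rewrite mulrDr.
rewrite big_split /= -mulr_suml; have [s0 ->] := hs (signal i w); rewrite mul1r.
rewrite -[Y w]/(Yc (signal i w)); set c := signal i w; rewrite /q.
have h1 : \sum_a s c a * Psi w a (y (pt c)) <= \sum_a s c a * Psi w a (Yc c) + L * eta.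
  rewrite -lerBlDl -sumrB; under eq_bigr do rewrite -mulrBr.
  apply: le_trans (ler_norm _) _; apply: dist_norm_le => // a.
  by apply: le_trans (PsiL _ _ _ _) _; rewrite ler_wpM2l.
have h2 : (y (pt c) - Yc c) ^+ 2 <= eta ^+ 2.
  by rewrite -real_normK ?num_real// ler_pXn2r ?nnegrE.
have : M * (y (pt c) - Yc c) ^+ 2 <= M * eta ^+ 2 by rewrite ler_pM2l.
rewrite (_ : M * (y (pt c) - h w) ^+ 2 = M * (y (pt c) - Yc c) ^+ 2 +
  M * (Yc c - h w) ^+ 2 + 2 * M * (y (pt c) - Yc c) * (Yc c - h w)); last ring.
by lra.
Qed.

(** An announcement at distance [x] from the true belief gains at most [L * x] through [Psi] and
    pays [M * x ^+ 2]; completing the square bounds the net gain by [L ^+ 2 / (4 * M)]. The strategy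
    [s] forgets the announcement. *)
Lemma scored_deviation (s' : nat -> A * G -> R) : strategy s' ->
  exists2 s : nat -> A -> R, strategy s & forall B L Psi, tame B L Psi ->
    mean P i s (fun w a => Psi w a (Y w)) + M * V - L ^+ 2 / (4 * M) <=
    mean P i s' (scored Psi).
Proof.
move=> hs'; exists (fun c a => \sum_m s' c (a, m)).
  move=> c; have [s0 s1] := hs' c; split=> [a|]; first exact: sumr_ge0.
  by rewrite pair_bigA -s1; apply: eq_bigr => -[].
move=> BPsi L Psi [PsiB L0 PsiL].
pose q c := \sum_am s' c am * (2 * M * (y am.2 - Yc c)).
have qB c : `|q c| <= 2 * M * (By + Bh).
  apply: dist_norm_le => // am; rewrite normrM gtr0_norm ?mulr_gt0// ler_pM2l ?mulr_gt0//.
  by rewrite (le_trans (ler_normB _ _))// lerD//; exact: Ex_norm_bound.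
have bq : bounded (fun w => q (signal i w) * (Y w - h w)).
  by apply: boundedM; [exists (2 * M * (By + Bh))|exact: boundedB].
have margE w (F : A -> R) : \sum_a (\sum_m s' (signal i w) (a, m)) * F a =
    \sum_am s' (signal i w) am * F am.1.
  transitivity (\sum_a \sum_m s' (signal i w) (a, m) * F a).
    by apply: eq_bigr => a _; rewrite mulr_suml.
  by rewrite pair_bigA; apply: eq_bigr => -[].
have bPsi : bounded (fun w => \sum_am s' (signal i w) am * Psi w am.1 (Y w)).
  by exists BPsi => w; exact: dist_norm_le.
rewrite /mean; under eq_Ex do rewrite margE.
rewrite -[M * V]addr0 -[X in M * V + X](ortho qB) -ExZ// -ExD//; last first.
  by apply: boundedM => //; exact: bounded_cst.
have b3 : bounded (fun w => M * (Y w - h w) ^+ 2 + q (signal i w) * (Y w - h w)).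
  by apply: boundedD => //; apply: boundedM => //; exact: bounded_cst.
rewrite -ExD// -[X in _ - X](Ex_cst P) -ExB//; [|exact: boundedD|exact: bounded_cst].
apply: Ex_le.
- by apply: boundedB; [exact: boundedD|exact: bounded_cst].
- exists (BPsi + M * (By + Bh) ^+ 2) => w; apply: dist_norm_le => // am.
  by rewrite (le_trans (ler_normD _ _))// lerD// score_le.
move=> w; rewrite -[Y w]/(Yc (signal i w)); set c := signal i w; rewrite /q.
have [s0 s1] := hs' c.
have wsum x : x = \sum_am s' c am * x by rewrite -mulr_suml s1 mul1r.
rewrite [M * (Yc c - h w) ^+ 2]wsum [L ^+ 2 / (4 * M)]wsum mulr_suml.
rewrite -!big_split -sumrB /=; apply: ler_sum => am _.
rewrite -mulrA -!mulrDr -mulrBr; apply: ler_wpM2l => //; rewrite /scored.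
set d := y am.2 - Yc c.
have h1 : Psi w am.1 (Yc c) - Psi w am.1 (y am.2) <= L * `|d|.
  by apply: le_trans (ler_norm _) _; rewrite /d distrC.
have h2 : L * `|d| - L ^+ 2 / (4 * M) <= M * d ^+ 2.
  rewrite -(@real_normK _ d) ?num_real// -subr_ge0.
  rewrite (_ : _ - _ = M * (`|d| - L / (2 * M)) ^+ 2); last by field; rewrite gt_eqF.
  by rewrite mulr_ge0 ?sqr_ge0// ltW.
rewrite (_ : M * (y am.2 - h w) ^+ 2 = M * d ^+ 2 +
  M * (Yc c - h w) ^+ 2 + 2 * M * d * (Yc c - h w)); last by rewrite /d; ring.
by lra.
Qed.

End Announcement.

Section Elicitation.
Variables (P : info R hK) (h : triple hK -> R) (Bh : R).
Hypothesis hB : forall w, `|h w| <= Bh.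
Variables (A B G : finType) (A0 : (0 < #|A|)%N) (B0 : (0 < #|B|)%N) (y : G -> R) (By : R).
Hypothesis yB : forall m, `|y m| <= By.
Variables (eta M : R).
Hypothesis eta0 : 0 <= eta.
Hypothesis grid : forall r, `|r| <= Bh -> exists m, `|y m - r| <= eta.
Hypothesis M0 : 0 < M.
Variables (Phi : triple hK -> A -> B -> R -> R) (BPhi L : R).
Hypothesis PhiB : forall w a b r, `|Phi w a b r| <= BPhi.
Hypothesis L0 : 0 <= L.
Hypothesis PhiL : forall w a b r r',
  `|Phi w a b r - Phi w a b r'| <= L * `|r - r'|.

Let err := L * eta + M * eta ^+ 2 + L ^+ 2 / (4 * M).
Let V i := Ex P (fun w => (condE P (signal i) h w - h w) ^+ 2).

Let truthB i (w : triple hK) (a : A) (b : B) :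
  `|Phi w a b (condE P (signal i) h w)| <= BPhi + M * (By + Bh) ^+ 2.
Proof. by rewrite (le_trans (PhiB _ _ _ _))// lerDl mulr_ge0 ?sqr_ge0// ltW. Qed.

Let sqB (w : triple hK) m : `|M * (y m - h w) ^+ 2| <= M * (By + Bh) ^+ 2.
Proof.
rewrite normrM (gtr0_norm M0) ler_pM2l// normrX.
have yh : `|y m - h w| <= By + Bh by rewrite (le_trans (ler_normB _ _))// lerD.
by rewrite ler_pXn2r ?nnegrE// (le_trans _ yh).
Qed.

Let scoreB (w : triple hK) a b m :
  `|Phi w a b (y m) + M * (y m - h w) ^+ 2| <= BPhi + M * (By + Bh) ^+ 2.
Proof. by rewrite (le_trans (ler_normD _ _))// lerD. Qed.

Let scoreB' (w : triple hK) a b m :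
  `|Phi w a b (y m) - M * (y m - h w) ^+ 2| <= BPhi + M * (By + Bh) ^+ 2.
Proof. by rewrite (le_trans (ler_normB _ _))// lerD. Qed.

Let G0 : (0 < #|G|)%N.
Proof.
have Bh0 : 0 <= Bh by exact: le_trans (normr_ge0 _) (hB point).
have [|m _] := @grid 0; first by rewrite normr0.
by apply/card_gt0P; exists m.
Qed.

Let AG0 : (0 < #|{: A * G}|)%N. Proof. by rewrite card_prod muln_gt0 A0. Qed.
Let BG0 : (0 < #|{: B * G}|)%N. Proof. by rewrite card_prod muln_gt0 B0. Qed.

(** The maximizer's strategy is kept and only replies are translated: [scored_truthful] bounds the
    value with announcements from above, [scored_deviation] from below. *)
Lemma elicit_minimizer :
  `|gval P (fun w a (bm : B * G) => Phi w a bm.1 (y bm.2) + M * (y bm.2 - h w) ^+ 2)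
    - (gval P (fun w a b => Phi w a b (condE P (signal false) h w)) + M * V false)|
  <= err.
Proof.
set v1 := gval P _; set v := gval P _.
have tameP (s : nat -> A -> R) : strategy s ->
    tame BPhi L (fun w b r => \sum_a s w.1.2 a * Phi w a b r).
  move=> hs; split=> // [w b r|w b r r']; first exact: dist_norm_le.
  by rewrite -sumrB; under eq_bigr do rewrite -mulrBr; exact: dist_norm_le.
have sE (s : nat -> A -> R) t : strategy s ->
    gpay P (fun w a (bm : B * G) => Phi w a bm.1 (y bm.2) + M * (y bm.2 - h w) ^+ 2) s t
    = mean P false t (scored h y M (fun w b r => \sum_a s w.1.2 a * Phi w a b r)).
  move=> hs; rewrite gpay_mean2; apply: eq_Ex => w; apply: eq_bigr => -[b m] _.
  congr (_ * _); rewrite /scored /=; under eq_bigr do rewrite mulrDr.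
  by rewrite big_split -mulr_suml /=; have [_ ->] := hs w.1.2; rewrite mul1r.
have le1 : 1 * v1 - (M * V false + (L * eta + M * eta ^+ 2)) <= v.
  apply: (@maxmin_le _ _ _ _ _ _ _ _ _ _ _ (BPhi + M * (By + Bh) ^+ 2)) => //.
  - exact: strategy_nonempty.
  - exact: strategy_nonempty.
  - exact: strategy_nonempty.
  - by move=> s t hs ht; apply: gpay_norm_le => // w a b; exact: scoreB.
  - by move=> s t hs ht; exact: gpay_norm_le.
  - move=> s hs; exists s => // t ht.
    have [t' ht' h'] := scored_truthful P false hB yB M0 ht eta0 grid.
    exists t' => //; rewrite sE// gpay_mean2 mul1r.
    by have := h' _ _ _ (tameP s hs); rewrite /V; lra.
have le2 : 1 * v - (- (M * V false) + L ^+ 2 / (4 * M)) <= v1.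
  apply: (@maxmin_le _ _ _ _ _ _ _ _ _ _ _ (BPhi + M * (By + Bh) ^+ 2)) => //.
  - exact: strategy_nonempty.
  - exact: strategy_nonempty.
  - exact: strategy_nonempty.
  - by move=> s t hs ht; exact: gpay_norm_le.
  - by move=> s t hs ht; apply: gpay_norm_le => // w a b; exact: scoreB.
  - move=> s hs; exists s => // t' ht'.
    have [t ht h'] := scored_deviation P false hB yB M0 ht'.
    exists t => //; rewrite sE// gpay_mean2 mul1r.
    by have := h' _ _ _ (tameP s hs); rewrite /V; lra.
have : 0 <= L * eta + M * eta ^+ 2.
  by rewrite addr_ge0// mulr_ge0// ?sqr_ge0// ltW.
have : 0 <= L ^+ 2 / (4 * M) by rewrite divr_ge0 ?sqr_ge0// mulr_ge0// ltW.
move: le1 le2; rewrite /err !mul1r; set x := M * V false; set y1 := L ^+ 2 / _.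
by set z := L * eta + _ => *; rewrite ler_norml; lra.
Qed.

(** Here the announcing strategy must be translated before the reply is known, which is why the two
    lemmas on [scored] find strategies independent of [Psi]. The score is subtracted, since the
    announcing player maximizes. *)
Lemma elicit_maximizer :
  `|gval P (fun w (am : A * G) b => Phi w am.1 b (y am.2) - M * (y am.2 - h w) ^+ 2)
    - (gval P (fun w a b => Phi w a b (condE P (signal true) h w)) - M * V true)|
  <= err.
Proof.
set v1 := gval P _; set v := gval P _.
have tameP (t : nat -> B -> R) : strategy t ->
    tame BPhi L (fun w a r => - \sum_b t w.2 b * Phi w a b r).
  move=> ht; split=> // [w a r|w a r r']; first by rewrite normrN; exact: dist_norm_le.
  rewrite -opprB normrN opprK addrC -sumrB.
  by under eq_bigr do rewrite -mulrBr; exact: dist_norm_le.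
have tE (s : nat -> A * G -> R) t : strategy s -> strategy t ->
    gpay P (fun w (am : A * G) b => Phi w am.1 b (y am.2) - M * (y am.2 - h w) ^+ 2) s t
    = - mean P true s (scored h y M (fun w a r => - \sum_b t w.2 b * Phi w a b r)).
  move=> hs ht; rewrite gpay_mean1 -mulN1r -ExZ; last first.
    exists (BPhi + M * (By + Bh) ^+ 2) => w; apply: dist_norm_le => // am.
    rewrite /scored (le_trans (ler_normD _ _))// lerD//.
    by rewrite normrN; exact: dist_norm_le.
  apply: eq_Ex => w; rewrite mulr_sumr; apply: eq_bigr => -[a m] _.
  rewrite mulN1r -[RHS]mulrN; congr (_ * _); rewrite /scored /= opprD opprK.
  under eq_bigr do rewrite mulrBr.
  by rewrite sumrB -mulr_suml; have [_ ->] := ht w.2; rewrite mul1r.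
have tE' (s : nat -> A -> R) t : strategy s -> strategy t ->
    mean P true s (fun w a => - \sum_b t w.2 b * Phi w a b (condE P (signal true) h w))
    = - gpay P (fun w a b => Phi w a b (condE P (signal true) h w)) s t.
  move=> hs ht; rewrite gpay_mean1 -mulN1r -ExZ; last first.
    exists BPhi => w; apply: dist_norm_le => // a; exact: dist_norm_le.
  apply: eq_Ex => w; rewrite mulr_sumr; apply: eq_bigr => a _.
  by rewrite mulN1r mulrN.
have le1 : 1 * v - (M * V true + (L * eta + M * eta ^+ 2)) <= v1.
  apply: (@maxmin_le _ _ _ _ _ _ _ _ _ _ _ (BPhi + M * (By + Bh) ^+ 2)) => //.
  - exact: strategy_nonempty.
  - exact: strategy_nonempty.
  - exact: strategy_nonempty.
  - by move=> s t hs ht; exact: gpay_norm_le.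
  - by move=> s t hs ht; apply: gpay_norm_le => // w a b; exact: scoreB'.
  - move=> s hs.
    have [s' hs' h'] := scored_truthful P true hB yB M0 hs eta0 grid.
    exists s' => // t ht; exists t => //; rewrite tE// mul1r.
    by have := h' _ _ _ (tameP t ht); rewrite tE'// /V; lra.
have le2 : 1 * v1 - (- (M * V true) + L ^+ 2 / (4 * M)) <= v.
  apply: (@maxmin_le _ _ _ _ _ _ _ _ _ _ _ (BPhi + M * (By + Bh) ^+ 2)) => //.
  - exact: strategy_nonempty.
  - exact: strategy_nonempty.
  - exact: strategy_nonempty.
  - by move=> s t hs ht; apply: gpay_norm_le => // w a b; exact: scoreB'.
  - by move=> s t hs ht; exact: gpay_norm_le.
  - move=> s' hs'.
    have [s hs h'] := scored_deviation P true hB yB M0 hs'.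
    exists s => // t ht; exists t => //; rewrite tE// mul1r.
    by have := h' _ _ _ (tameP t ht); rewrite tE'// /V; lra.
have : 0 <= L * eta + M * eta ^+ 2.
  by rewrite addr_ge0// mulr_ge0// ?sqr_ge0// ltW.
have : 0 <= L ^+ 2 / (4 * M) by rewrite divr_ge0 ?sqr_ge0// mulr_ge0// ltW.
move: le1 le2; rewrite /err !mul1r; set x := M * V true; set y1 := L ^+ 2 / _.
by set z := L * eta + _ => *; rewrite ler_norml; lra.
Qed.

End Elicitation.

End BayesianGames.

(** * Statistics *)

Section Statistics.
Context {R : realType} {K : finType} {hK : (1 < #|K|)%N}.

(** A random variable defined on all information structures at once, so that it can be compared
    between [u] and [u_ n]. *)
Definition process : Type := info R hK -> triple hK -> R.

(* [stat b (Some i) X]: X is a function of player i's hierarchy and, if b holds,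
   of the state. In [stat b None X], both hierarchies may be used. *)
Inductive stat : bool -> option bool -> process -> Prop :=
| stat_cst b o c : stat b o (fun _ _ => c)
| stat_add b o X Y : stat b o X -> stat b o Y -> stat b o (fun v w => X v w + Y v w)
| stat_scale b o c X : stat b o X -> stat b o (fun v w => c * X v w)
| stat_max b o X Y : stat b o X -> stat b o Y ->
    stat b o (fun v w => Num.max (X v w) (Y v w))
| stat_state o (f : K -> R) X : stat true o X -> stat true o (fun v w => f w.1.1 * X v w)
| stat_belief b i X : stat true (Some (~~ i)) X ->
    stat b (Some i) (fun v => condE v (signal i) (X v))
| stat_joint b i X : stat b (Some i) X -> stat b None X.

Lemma stat_opp b o X : stat b o X -> stat b o (fun v w => - X v w).
Proof.
move=> sX; have := stat_scale (-1) sX; congr stat.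
by apply/funext => v; apply/funext => w; rewrite mulN1r.
Qed.

Lemma stat_sub b o X Y : stat b o X -> stat b o Y -> stat b o (fun v w => X v w - Y v w).
Proof. by move=> sX sY; apply: stat_add => //; exact: stat_opp. Qed.

Lemma stat_norm b o X : stat b o X -> stat b o (fun v w => `|X v w|).
Proof.
move=> sX; have := stat_max sX (stat_opp sX); congr stat.
by apply/funext => v; apply/funext => w; rewrite maxrN.
Qed.

Lemma stat_sum b o (I : Type) (r : seq I) (D : pred I) (X : I -> process) :
  (forall i, stat b o (X i)) -> stat b o (fun v w => \sum_(i <- r | D i) X i v w).
Proof.
move=> sX; elim: r => [|i r IH].
  have := stat_cst b o 0; congr stat.
  by apply/funext => v; apply/funext => w; rewrite big_nil.
case Di : (D i).
  have := stat_add (sX i) IH; congr stat.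
  by apply/funext => v; apply/funext => w; rewrite big_cons Di.
by move: IH; congr stat; apply/funext => v; apply/funext => w; rewrite big_cons Di.
Qed.

Lemma stat_bounded b o X : stat b o X -> exists B : R, forall v w, `|X v w| <= B.
Proof.
elim=> {b o X} [b o c|b o X Y _ [B hB] _ [C hC]|b o c X _ [B hB]|b o X Y _ [B hB] _ [C hC]
  |o f X _ [B hB]|b i X _ [B hB]|b i X _ //].
- by exists `|c|.
- by exists (B + C) => v w; rewrite (le_trans (ler_normD _ _))// lerD.
- by exists (`|c| * B) => v w; rewrite normrM ler_wpM2l.
- exists (Num.max B C) => v w; rewrite le_max.
  by case: (leP (X v w) (Y v w)) => _; rewrite ?hB ?hC ?orbT.
- exists ((\sum_k `|f k|) * B) => v w; rewrite normrM ler_pM//.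
  by rewrite (bigD1 (w.1.1 : K))//= lerDl sumr_ge0.
- by exists B => v w; exact: Ex_norm_bound.
Qed.

Lemma stat_bounded_at b o X v : stat b o X -> bounded (X v).
Proof. by move=> /stat_bounded[B hB]; exists B. Qed.

Lemma stat_signal i X : stat false (Some i) X -> forall v w w',
  signal i w = signal i w' -> X v w = X v w'.
Proof.
move=> sX; suff H b o Y : stat b o Y -> b = false -> o = Some i ->
    forall v w w', signal i w = signal i w' -> Y v w = Y v w' by exact: (H _ _ _ sX).
elim=> {b o Y} //=.
- by move=> b o Y Z _ hY _ hZ b0 oi v w w' e; rewrite (hY b0 oi v w w')// (hZ b0 oi v w w').
- by move=> b o c Y _ hY b0 oi v w w' e; rewrite (hY b0 oi v w w').
- by move=> b o Y Z _ hY _ hZ b0 oi v w w' e; rewrite (hY b0 oi v w w')// (hZ b0 oi v w w').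
- by move=> b k Y _ _ _ [->] v w w' e; rewrite /condE e.
Qed.

End Statistics.

Section Clip.
Context {R : realType}.

(** Truncation to the interval from [-B] to [B], which turns a real coordinate into a bounded
    Lipschitz function. *)
Definition clip (B r : R) : R := Num.max (- B) (Num.min B r).

Lemma clip_id (B r : R) : `|r| <= B -> clip B r = r.
Proof.
by rewrite ler_norml /clip => /andP[h1 h2]; rewrite min_r// max_r.
Qed.

Lemma clip_bound (B r : R) : 0 <= B -> `|clip B r| <= B.
Proof.
by move=> B0; rewrite ler_norml /clip le_max lexx/= ge_max ge_min lexx/= andbT; lra.
Qed.

Lemma clip_lip (B r s : R) : `|clip B r - clip B s| <= `|r - s|.
Proof.
rewrite /clip; have := ler_norm (r - s); have := ler_norm (s - r); rewrite (distrC s r).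
have := normr_ge0 (r - s).
case: (leP B r) => ?; case: (leP B s) => ?; case: (leP (- B) B) => ?;
  case: (leP (- B) r) => ?; case: (leP (- B) s) => ?; rewrite ler_norml; lra.
Qed.

Lemma max_lip (a b c d : R) : `|Num.max a b - Num.max c d| <= `|a - c| + `|b - d|.
Proof.
have := ler_norm (a - c); have := ler_norm (c - a); rewrite (distrC c a).
have := ler_norm (b - d); have := ler_norm (d - b); rewrite (distrC d b).
by case: (leP a b); case: (leP c d); rewrite ler_norml; lra.
Qed.

Lemma grid_exists (B eta : R) : 0 < eta -> exists (G : finType) (y : G -> R) (By : R),
  (forall m, `|y m| <= By) /\ (forall r, `|r| <= B -> exists m, `|y m - r| <= eta).
Proof.
move=> eta0; pose N := Num.truncn (2 * B / eta).
exists 'I_N.+1, (fun m : 'I_N.+1 => - B + eta * m%:R), (`|B| + eta * N%:R); split=> [m|r].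
  rewrite (le_trans (ler_normD _ _))// normrN lerD2l// normrM gtr0_norm// ler_pM2l//.
  by rewrite normr_nat ler_nat -ltnS.
rewrite ler_norml => /andP[h1 h2].
have x0 : 0 <= (r + B) / eta by rewrite divr_ge0//; [lra|exact: ltW].
have /andP[t1 t2] := truncn_itv x0.
have mN : (Num.truncn ((r + B) / eta) < N.+1)%N.
  by rewrite ltnS; apply: le_truncn; rewrite ler_pM2r ?invr_gt0//; lra.
exists (Ordinal mN) => /=; set m := Num.truncn _ in t1 t2 *.
move: t1 t2; rewrite ler_pdivlMr// ltr_pdivrMr// -natr1 mulrDl mul1r => t1 t2.
by rewrite ler_norml; lra.
Qed.

End Clip.

(** * From convergence of values to convergence of statistics *)

Section ValueConvergence.
Context {R : realType} {K : finType} {hK : (1 < #|K|)%N}.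
Variables (u : info R hK) (u_ : nat -> info R hK).
Hypothesis cvg_vdist : vdist (u_ n) u @[n --> \oo] --> (0 : R).

Let convergent (f : info R hK -> R) := f (u_ n) @[n --> \oo] --> f u.

Lemma convergent_approx f :
  (forall e, 0 < e -> exists2 g, convergent g & forall v, `|f v - g v| <= e) ->
  convergent f.
Proof.
move=> h; apply/cvgrPdist_le => e e0.
have e3 : 0 < e / 3 by lra.
have [g cg fg] := h _ e3; move/cvgrPdist_le : cg => /(_ _ e3); apply: filterS => n.
have := fg u; have := fg (u_ n); rewrite !ler_norml; lra.
Qed.

Lemma game_val_bounded P (I J : finType) (g : K -> I -> J -> R) :
  (0 < #|I|)%N -> (0 < #|J|)%N -> (forall k i j, `|g k i j| <= 1) ->
  `|@game_val R K hK I J P g| <= 1.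
Proof.
move=> I0 J0 g1; rewrite game_valE.
by apply: maxmin_norm_le; [exact: strategy_nonempty..|move=> s t hs ht; exact: gpay_norm_le].
Qed.


Lemma vdist_ub v w (I J : finType) (g : K -> I -> J -> R) : (0 < #|I|)%N -> (0 < #|J|)%N ->
  (forall k i j, `|g k i j| <= 1) -> `|game_val v g - game_val w g| <= @vdist R K hK v w.
Proof.
move=> I0 J0 g1; apply: ub_le_sup; last first.
  by exists I, J, g; split=> // k i j; rewrite -ler_norml.
exists 2 => _ [I' [J' [g' [I'0 J'0 g'1 ->]]]].
have g'B k i j : `|g' k i j| <= 1 by rewrite ler_norml.
rewrite (le_trans (ler_normB _ _))// (_ : 2 = 1 + 1)//.
by rewrite lerD// game_val_bounded.
Qed.

Lemma gval_scale P (A B : finType) (Z : triple hK -> A -> B -> R) C D :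
  (0 < #|A|)%N -> (0 < #|B|)%N -> (forall w a b, `|Z w a b| <= D) -> 0 < C ->
  gval P (fun w a b => C * Z w a b) = C * gval P Z.
Proof.
move=> A0 B0 ZD C0.
have ZD' w a b : `|C * Z w a b| <= C * D by rewrite normrM gtr0_norm// ler_pM2l.
have pE s t : strategy s -> strategy t ->
    gpay P (fun w a b => C * Z w a b) s t = C * gpay P Z s t.
  move=> hs ht; rewrite -ExZ; last by exists D => w; exact: bilin_norm_le.
  apply: eq_Ex => w; rewrite /bilin mulr_sumr; apply: eq_bigr => a _.
  by rewrite mulr_sumr; apply: eq_bigr => b _; rewrite mulrCA.
have D0 : 0 <= D.
  have /card_gt0P[a _] := A0; have /card_gt0P[b _] := B0.
  exact: le_trans (normr_ge0 _) (ZD point a b).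
have D1 : D <= C * D + D by rewrite lerDr mulr_ge0// ltW.
have D2 : C * D <= C * D + D by rewrite lerDl.
apply/le_anti/andP; split; last first.
  rewrite -[leLHS]subr0; apply: (@maxmin_le _ _ _ _ _ _ _ _ _ _ _ (C * D + D)) => //.
  - exact: strategy_nonempty.
  - exact: strategy_nonempty.
  - exact: strategy_nonempty.
  - by move=> s t hs ht; apply: gpay_norm_le => // w a b; exact: le_trans (ZD _ _ _) D1.
  - by move=> s t hs ht; apply: gpay_norm_le => // w a b; exact: le_trans (ZD' _ _ _) D2.
  - by move=> s hs; exists s => // t ht; exists t => //; rewrite subr0 pE.
rewrite mulrC -ler_pdivrMr// mulrC -[leLHS]subr0.
apply: (@maxmin_le _ _ _ _ _ _ _ _ _ _ _ (C * D + D)) => //.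
- exact: strategy_nonempty.
- exact: strategy_nonempty.
- exact: strategy_nonempty.
- by rewrite invr_gt0.
- by move=> s t hs ht; apply: gpay_norm_le => // w a b; exact: le_trans (ZD' _ _ _) D2.
- by move=> s t hs ht; apply: gpay_norm_le => // w a b; exact: le_trans (ZD _ _ _) D1.
- move=> s hs; exists s => // t ht; exists t => //.
  by rewrite subr0 pE// mulKf// gt_eqF.
Qed.

(** The payoff is divided by [D] to lie between -1 and 1, where [vdist] controls the values. *)
Lemma cvg_gval (A B : finType) (g : K -> A -> B -> R) C : (0 < #|A|)%N -> (0 < #|B|)%N ->
  (forall k i j, `|g k i j| <= C) -> convergent (fun v => gval v (fun w => g w.1.1)).
Proof.
move=> A0 B0 gC; pose D := `|C| + 1; have D0 : 0 < D by rewrite ltr_wpDl.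
pose g' k i j := D^-1 * g k i j.
have g'1 k i j : `|g' k i j| <= 1.
  rewrite normrM gtr0_norm ?invr_gt0// mulrC ler_pdivrMr// mul1r.
  by rewrite (le_trans (gC _ _ _))// (le_trans (ler_norm _))// lerDl.
have gE (v : info R hK) : gval v (fun w => g w.1.1) = D * game_val v g'.
  rewrite game_valE; transitivity (gval v (fun w a b => D * g' w.1.1 a b)).
    congr gval; apply/funext => w; apply/funext => a; apply/funext => b.
    by rewrite /g' mulVKf// gt_eqF.
  exact: (@gval_scale _ _ _ _ _ 1).
apply/cvgrPdist_le => e e0; have e1 : 0 < e / D by rewrite divr_gt0.
move/cvgrPdist_le : cvg_vdist => /(_ _ e1); apply: filterS => n.
rewrite sub0r normrN => h; rewrite !gE -mulrBr normrM gtr0_norm// mulrC -ler_pdivlMr//.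
rewrite distrC (le_trans (vdist_ub (u_ n) u A0 B0 g'1))// (le_trans _ h)//.
exact: ler_norm.
Qed.

(** Values converge even when the payoff uses [X] as if it were contractible upon. The Lipschitz
    condition makes the class of payoffs stable under replacing a true belief by an announced
    number. *)
Definition elicitable (E : Type) (e : E -> E -> R) (X : info R hK -> triple hK -> E) :=
  forall (I J : finType) (Phi : K -> I -> J -> E -> R) B L,
    (0 < #|I|)%N -> (0 < #|J|)%N -> 0 <= L ->
    (forall k i j x, `|Phi k i j x| <= B) ->
    (forall k i j x y, `|Phi k i j x - Phi k i j y| <= L * e x y) ->
  convergent (fun v => gval v (fun w i j => Phi w.1.1 i j (X v w))).

Definition pair_dist (E : Type) (e : E -> E -> R) (p q : E * R) : R :=
  e p.1 q.1 + `|p.2 - q.2|.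

Lemma elicitable_const : elicitable (fun _ _ : unit => 0) (fun _ _ => tt).
Proof.
move=> I J Phi B L I0 J0 _ PhiB _.
exact: (@cvg_gval I J (fun k i j => Phi k i j tt) B I0 J0 (fun k i j => PhiB k i j tt)).
Qed.

Lemma elicitable_comp E (e : E -> E -> R) X E' (e' : E' -> E' -> R) (p : K -> E -> E') c :
  0 <= c -> (forall k x y, e' (p k x) (p k y) <= c * e x y) ->
  elicitable e X -> elicitable e' (fun v w => p w.1.1 (X v w)).
Proof.
move=> c0 pc eX I J Phi B L I0 J0 L0 PhiB PhiL.
apply: (eX I J (fun k i j x => Phi k i j (p k x)) B (L * c)) => //.
  exact: mulr_ge0.
move=> k i j x y; rewrite (le_trans (PhiL _ _ _ _ _))// -mulrA.
by rewrite ler_wpM2l.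
Qed.

(* The payoff with the true belief h is approximated by the payoff with an
   announced belief plus M times a quadratic score; the expected conditional
   variance that the score adds is itself the value of a game. *)
Lemma elicitable_belief E (e : E -> E -> R) X (h : E -> R) Bh Lh i :
  (forall x y, 0 <= e x y) -> (forall x, e x x = 0) -> 0 <= Lh ->
  (forall x, `|h x| <= Bh) ->
  (forall x y, `|h x - h y| <= Lh * e x y) -> elicitable e X ->
  elicitable (pair_dist e)
    (fun v w => (X v w, condE v (signal i) (fun w' => h (X v w')) w)).
Proof.
move=> e0 exx Lh0 hB hL eX I J Phi B L I0 J0 L0 PhiB PhiL.
have [x0 _] : exists x : E, True by exists (X u point).
have Bh0 : 0 <= Bh by exact: le_trans (normr_ge0 _) (hB x0).
have B0 : 0 <= B.
  have /card_gt0P[a _] := I0; have /card_gt0P[b _] := J0.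
  exact: le_trans (normr_ge0 _) (PhiB (point : state hK) a b (x0, 0)).
have sqL By c c' d : `|c| <= By -> `|(c - h d) ^+ 2 - (c - h c') ^+ 2|
    <= 2 * (By + Bh) * Lh * e d c'.
  move=> cB; rewrite (_ : _ - _ = (h c' - h d) * (2 * c - h d - h c')); last ring.
  rewrite normrM mulrC -[leRHS]mulrA; apply: ler_pM => //; last by rewrite distrC.
  rewrite (le_trans (ler_normB _ _))// mulrDr [2 * Bh]mulrDl mul1r addrA lerD//.
  rewrite (le_trans (ler_normB _ _))// lerD// normrM ger0_norm// ler_pM2l//.
have sqB By c d : `|c| <= By -> `|(c - h d) ^+ 2| <= (By + Bh) ^+ 2.
  move=> cB; have ch : `|c - h d| <= By + Bh by rewrite (le_trans (ler_normB _ _))// lerD.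
  by rewrite normrX ler_pXn2r ?nnegrE// (le_trans _ ch).
apply: convergent_approx => eta eta0.
(* This [M] brings the gain from misreporting, [L ^+ 2 / (4 * M)], below [eta / 4]; adding 1 keeps
   it positive when [L] is zero. *)
pose M := L ^+ 2 / eta + 1.
have M0 : 0 < M by rewrite ltr_wpDl// divr_ge0 ?sqr_ge0// ltW.
(* The mesh of the announcements. With [d <= 1] the squares are at most [d], and the rounding errors
   of both games add up to at most [(L + 2 * M) * d], that is [eta / 4]. *)
pose d := Num.min 1 (eta / (4 * (L + 2 * M))).
have LM0 : 0 < 4 * (L + 2 * M) by rewrite mulr_gt0// ltr_wpDl// mulr_gt0.
have d0 : 0 < d by rewrite lt_min ltr01/= divr_gt0.
have d1 : d <= 1 by rewrite ge_min lexx.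
have dLM : d * (4 * (L + 2 * M)) <= eta by rewrite -ler_pdivlMr// ge_min lexx orbT.
have dd : d ^+ 2 <= d by rewrite -[leRHS]mulr1 expr2 ler_pM2l.
have [G [y [By [yB grid]]]] := grid_exists Bh d0.
have G0 : (0 < #|G|)%N.
  by have [|m _] := grid 0; [rewrite normr0|apply/card_gt0P; exists m].
have LM : L ^+ 2 / (4 * M) <= eta / 4.
  rewrite ler_pdivrMr ?mulr_gt0//.
  by rewrite (_ : eta / 4 * (4 * M) = L ^+ 2 + eta);
    [rewrite lerDl ltW|rewrite /M; field; rewrite gt_eqF].
have err1 : L * d + M * d ^+ 2 + L ^+ 2 / (4 * M)
    + M * (0 * d + 1 * d ^+ 2 + 0 ^+ 2 / (4 * 1)) <= eta.
  rewrite expr0n /= mul0r mul0r add0r addr0 mul1r.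
  have : M * d ^+ 2 <= M * d by rewrite ler_pM2l.
  by move: dLM; rewrite mulrCA mulrDr mulrCA; lra.
(* With payoff zero and weight 1 only the score is left, so this second game isolates the expected
   conditional variance. *)
pose zero (_ : K) (_ : I) (_ : J) (_ : E * R) : R := 0.
have zeroB k a b x : `|zero k a b x| <= 0 by rewrite normr0.
have zeroL k a b x x' : `|zero k a b x - zero k a b x'| <= 0 * pair_dist e x x'.
  by rewrite subrr normr0 mul0r.
have hXB v w : `|h (X v w)| <= Bh by [].
have c0 : convergent (fun v => gval v (fun w a b => zero w.1.1 a b (X v w, 0))).
  by apply: (@cvg_gval I J (fun _ _ _ => 0) 0) => // k a b; rewrite normr0.
have lipl (Psi : K -> I -> J -> E * R -> R) L' :
    (forall k i j x y, `|Psi k i j x - Psi k i j y| <= L' * pair_dist e x y) ->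
    forall k i j x x' r, `|Psi k i j (x, r) - Psi k i j (x', r)| <= L' * e x x'.
  move=> hL' k a b x x' r; have := hL' k a b (x, r) (x', r).
  by rewrite /pair_dist /= subrr normr0 addr0.
have lipr (Psi : K -> I -> J -> E * R -> R) L' :
    (forall k i j x y, `|Psi k i j x - Psi k i j y| <= L' * pair_dist e x y) ->
    forall k i j x r r', `|Psi k i j (x, r) - Psi k i j (x, r')| <= L' * `|r - r'|.
  move=> hL' k a b x r r'; have := hL' k a b (x, r) (x, r').
  by rewrite /pair_dist /= exx add0r.
have scoreB B' c x m (sg : R) : `|c| <= B' -> `|sg| = 1 -> forall M', 0 <= M' ->
    `|c + sg * (M' * (y m - h x) ^+ 2)| <= B' + M' * (By + Bh) ^+ 2.
  move=> cB sg1 M' M'0; rewrite (le_trans (ler_normD _ _))// lerD// normrM sg1 mul1r.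
  by rewrite normrM (ger0_norm M'0) ler_wpM2l// sqB.
have scoreL c c' L' x x' m (sg : R) M' : `|c - c'| <= L' * e x x' -> `|sg| = 1 -> 0 <= M' ->
    `|c + sg * (M' * (y m - h x) ^+ 2) - (c' + sg * (M' * (y m - h x') ^+ 2))|
    <= (L' + M' * (2 * (By + Bh) * Lh)) * e x x'.
  move=> cL sg1 M'0; rewrite opprD addrACA (le_trans (ler_normD _ _))// mulrDl lerD//.
  rewrite -mulrBr normrM sg1 mul1r -mulrBr normrM (ger0_norm M'0) -[leRHS]mulrA ler_wpM2l//.
  exact: sqL.
have BB0 : 0 <= By + Bh.
  have [|m _] := grid 0; first by rewrite normr0.
  by rewrite addr_ge0// (le_trans _ (yB m)).
(* [Z1] is the announcement game, [Z2] the game with the score only, and [Z0] the game with payoff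
   zero; [sg] is 1 if the minimizer announces and -1 if the maximizer does. The combination
   [Z1 - M (Z2 - Z0)] cancels the variance. *)
have final (F Z1 Z2 Z0 : info R hK -> R) (V : info R hK -> R) (sg : R) : `|sg| = 1 ->
    convergent Z1 -> convergent Z2 -> convergent Z0 ->
    (forall v, `|Z1 v - (F v + sg * (M * V v))| <= L * d + M * d ^+ 2 + L ^+ 2 / (4 * M)) ->
    (forall v, `|Z2 v - (Z0 v + sg * (1 * V v))| <= 0 * d + 1 * d ^+ 2 + 0 ^+ 2 / (4 * 1)) ->
    exists2 g, convergent g & forall v, `|F v - g v| <= eta.
  move=> sg1 c1 c2 c0' h1 h2; exists (fun v => Z1 v - M * (Z2 v - Z0 v)).
    by apply: cvgB => //; apply: cvgM; [exact: cvg_cst|exact: cvgB].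
  move=> v; apply: le_trans err1.
  rewrite (_ : F v - _ = M * (Z2 v - (Z0 v + sg * (1 * V v)))
    - (Z1 v - (F v + sg * (M * V v)))); last ring.
  rewrite (le_trans (ler_normB _ _))// addrC lerD// normrM gtr0_norm// ler_pM2l//.
have sN1 : `|-1 : R| = 1 by rewrite normrN normr1.
have s1 : `|1 : R| = 1 by rewrite normr1.
have cvT (Psi : K -> I -> J -> E * R -> R) B' L' M' : 0 <= L' -> 0 <= M' ->
    (forall k i j x, `|Psi k i j x| <= B') ->
    (forall k i j x y, `|Psi k i j x - Psi k i j y| <= L' * pair_dist e x y) ->
    convergent (fun v => gval v (fun w (am : I * G) b =>
      Psi w.1.1 am.1 b (X v w, y am.2) - M' * (y am.2 - h (X v w)) ^+ 2)).
  move=> L'0 M'0 PsiB PsiL.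
  apply: (eX _ J (fun k (am : I * G) b x => Psi k am.1 b (x, y am.2)
    - M' * (y am.2 - h x) ^+ 2) (B' + M' * (By + Bh) ^+ 2)
    (L' + M' * (2 * (By + Bh) * Lh))) => //.
  - by rewrite card_prod muln_gt0 I0.
  - by rewrite addr_ge0// !mulr_ge0.
  - by move=> k [a m] b x /=; rewrite -mulN1r; exact: scoreB.
  - move=> k [a m] b x x' /=; rewrite -[- (M' * (_ - h x) ^+ 2)]mulN1r.
    rewrite -[- (M' * (_ - h x') ^+ 2)]mulN1r; apply: scoreL => //; exact: lipl.
have cvF (Psi : K -> I -> J -> E * R -> R) B' L' M' : 0 <= L' -> 0 <= M' ->
    (forall k i j x, `|Psi k i j x| <= B') ->
    (forall k i j x y, `|Psi k i j x - Psi k i j y| <= L' * pair_dist e x y) ->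
    convergent (fun v => gval v (fun w a (bm : J * G) =>
      Psi w.1.1 a bm.1 (X v w, y bm.2) + M' * (y bm.2 - h (X v w)) ^+ 2)).
  move=> L'0 M'0 PsiB PsiL.
  apply: (eX I _ (fun k a (bm : J * G) x => Psi k a bm.1 (x, y bm.2)
    + M' * (y bm.2 - h x) ^+ 2) (B' + M' * (By + Bh) ^+ 2)
    (L' + M' * (2 * (By + Bh) * Lh))) => //.
  - by rewrite card_prod muln_gt0 J0.
  - by rewrite addr_ge0// !mulr_ge0.
  - by move=> k a [b m] x /=; rewrite -[M' * _]mul1r; exact: scoreB.
  - move=> k a [b m] x x' /=; rewrite -[M' * (_ - h x) ^+ 2]mul1r.
    by rewrite -[M' * (_ - h x') ^+ 2]mul1r; apply: scoreL => //; exact: lipl.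
pose V i' (v : info R hK) := Ex v (fun w =>
  (condE v (signal i') (fun w' => h (X v w')) w - h (X v w)) ^+ 2).
have M1 := ltW M0; have d00 := ltW d0.
have PhiB' v w a b r : `|Phi (w : triple hK).1.1 a b (X v w, r)| <= B by [].
have PhiL' v w a b r r' :
    `|Phi (w : triple hK).1.1 a b (X v w, r) - Phi w.1.1 a b (X v w, r')| <= L * `|r - r'|.
  exact: lipr.
have zB (w : triple hK) (a : I) (b : J) (r : R) : `|0 : R| <= 0 by rewrite normr0.
have zL (w : triple hK) (a : I) (b : J) (r r' : R) : `|0 - 0 : R| <= 0 * `|r - r'|.
  by rewrite subrr normr0 mul0r.
case: i.
- apply: (final _ _ _ _ (V true) (-1) sN1 (cvT Phi B L M L0 M1 PhiB PhiL)
    (cvT zero 0 0 1 (lexx 0) ler01 zeroB zeroL) c0) => v; rewrite mulN1r.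
  + exact: (@elicit_maximizer _ _ _ v _ Bh (hXB v) I J G I0 J0 y By yB
      d M d00 grid M0 _ B L (PhiB' v) L0 (PhiL' v)).
  + exact: (@elicit_maximizer _ _ _ v _ Bh (hXB v) I J G I0 J0 y By yB
      d 1 d00 grid ltr01 _ 0 0 zB (lexx 0) zL).
- apply: (final _ _ _ _ (V false) 1 s1 (cvF Phi B L M L0 M1 PhiB PhiL)
    (cvF zero 0 0 1 (lexx 0) ler01 zeroB zeroL) c0) => v; rewrite [1 * (_ * _)]mul1r.
  + exact: (@elicit_minimizer _ _ _ v _ Bh (hXB v) I J G I0 J0 y By yB
      d M d00 grid M0 _ B L (PhiB' v) L0 (PhiL' v)).
  + exact: (@elicit_minimizer _ _ _ v _ Bh (hXB v) I J G I0 J0 y By yB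
      d 1 d00 grid ltr01 _ 0 0 zB (lexx 0) zL).
Qed.

(** The induction runs over an arbitrary variable [Y] already elicitable, because a sum or a maximum
    needs its two arguments jointly: they are adjoined to [Y] one after the other, combined, and
    projected. *)
Lemma stat_elicitable b o X : stat b o X -> forall E (e : E -> E -> R) Y,
  (forall x y, 0 <= e x y) -> (forall x, e x x = 0) -> elicitable e Y ->
  elicitable (pair_dist e) (fun v w => (Y v w, X v w)).
Proof.
have pd0 E (e : E -> E -> R) : (forall x y, 0 <= e x y) -> forall x y, 0 <= pair_dist e x y.
  by move=> e0 x y; rewrite addr_ge0.
have pdxx E (e : E -> E -> R) : (forall x, e x x = 0) -> forall x, pair_dist e x x = 0.
  by move=> exx x; rewrite /pair_dist exx subrr normr0 addr0.
elim=> {b o X} [b o c|b o X Z _ hX _ hZ|b o c X _ hX|b o X Z _ hX _ hZ|o f X sX hX|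
  b i X sX hX|b i X _ //] E e Y e0 exx eY.
- apply: (@elicitable_comp _ e Y _ _ (fun _ x => (x, c)) 1) => // _ x y.
  by rewrite /pair_dist /= subrr normr0 addr0 mul1r.
- have eXZ := hZ _ _ _ (pd0 _ _ e0) (pdxx _ _ exx) (hX _ _ _ e0 exx eY).
  apply: (@elicitable_comp _ _ _ _ _ (fun _ x => (x.1.1, x.1.2 + x.2)) 1) eXZ => //.
  move=> _ [[x a] c] [[x' a'] c']; rewrite /pair_dist /= mul1r -[leRHS]addrA lerD2l.
  by rewrite opprD addrACA ler_normD.
- have eX := hX _ _ _ e0 exx eY.
  apply: (@elicitable_comp _ _ _ _ _ (fun _ x => (x.1, c * x.2)) (1 + `|c|)) eX => //.
  move=> _ [x a] [x' a']; rewrite /pair_dist /= mulrDr lerD// -?mulrBr ?normrM.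
    by rewrite ler_peMl// lerDl.
  by rewrite ler_wpM2r// lerDr.
- have eXZ := hZ _ _ _ (pd0 _ _ e0) (pdxx _ _ exx) (hX _ _ _ e0 exx eY).
  apply: (@elicitable_comp _ _ _ _ _ (fun _ x => (x.1.1, Num.max x.1.2 x.2)) 1) eXZ => //.
  move=> _ [[x a] c] [[x' a'] c']; rewrite /pair_dist /= mul1r -[leRHS]addrA lerD2l.
  exact: max_lip.
- have eX := hX _ _ _ e0 exx eY; pose C := \sum_k `|f k|.
  apply: (@elicitable_comp _ _ _ _ _ (fun k x => (x.1, f k * x.2)) (1 + C)) eX => //.
    by rewrite addr_ge0// sumr_ge0.
  move=> k [x a] [x' a']; rewrite /pair_dist /= mulrDr lerD// -?mulrBr ?normrM.
    by rewrite ler_peMl// lerDl sumr_ge0.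
  by rewrite ler_wpM2r// /C (bigD1 k)//= addrCA lerDl addr_ge0// sumr_ge0.
- have [B hB] := stat_bounded sX.
  have B0 : 0 <= B by exact: le_trans (normr_ge0 _) (hB u point).
  have eX := hX _ _ _ e0 exx eY.
  (* The coordinate ranges over all reals, so it is clipped at a bound of the statistic to make [h]
     bounded; on values of [X] clipping does nothing. *)
  have := elicitable_belief (i := i) (h := fun x => clip B x.2) (Bh := B) (Lh := 1)
    (pd0 _ _ e0) (pdxx _ _ exx) ler01 (fun x => clip_bound x.2 B0) _ eX.
  move=> /(_ _)/wrap[].
    move=> x x'; rewrite mul1r (le_trans (clip_lip _ _ _))// /pair_dist lerDr.
    exact: e0.
  move=> eB; have := @elicitable_comp _ _ _ _ (pair_dist e) (fun _ x => (x.1.1, x.2)) 1 ler01 _ eB.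
  move=> /(_ _)/wrap[].
    by move=> _ [[x a] c] [[x' a'] c']; rewrite /pair_dist /= mul1r lerD2r lerDl.
  congr elicitable; apply/funext => v; apply/funext => w /=; congr (_, _).
  by rewrite /condE; apply: eq_Ex => w'; rewrite clip_id.
Qed.

(** When each player has a single action, the value is the expectation of the payoff. *)
Lemma cvg_vdist_stat b o X : stat b o X -> Ex (u_ n) (X (u_ n)) @[n --> \oo] --> Ex u (X u).
Proof.
move=> sX; have [B hB] := stat_bounded sX.
have B0 : 0 <= B by exact: le_trans (normr_ge0 _) (hB u point).
have eX := stat_elicitable sX (fun _ _ => lexx _) (fun _ => erefl) elicitable_const.
have := eX unit unit (fun _ _ _ x => clip B x.2) B 1.
rewrite !card_unit => /(_ isT isT ler01) /(_ (fun _ _ _ x => clip_bound x.2 B0)).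
move=> /(_ _)/wrap[].
  by move=> _ _ _ x y; rewrite mul1r /pair_dist add0r clip_lip.
have vE v : gval v (fun w (_ _ : unit) => clip B (X v w)) = Ex v (X v).
  have n0 : @strategy R unit !=set0 by apply: strategy_nonempty; rewrite card_unit.
  apply: maxmin_cst => // s t hs ht; apply: eq_Ex => w; rewrite /bilin clip_id//.
  have one (s' : nat -> unit -> R) c : strategy s' -> s' c tt = 1.
    by move=> /(_ c)[_ <-]; rewrite (bigD1 tt)//= big1 ?addr0// => -[].
  have sum1 (F : unit -> R) : \sum_a F a = F tt.
    by rewrite (bigD1 tt)//= big1 ?addr0// => -[].
  by rewrite !sum1 !one// !mul1r.
by rewrite /convergent vE; under eq_fun do rewrite vE.
Qed.

End ValueConvergence.

(** * Weak convergence *)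

Section Topology.

Lemma cvg_initial (S : choiceType) (T : topologicalType) (f : S -> T)
    (F : set_system S) (s : S) : Filter F ->
  F --> (s : initial_topology f) <-> f x @[x --> F] --> f s.
Proof.
move=> FF; split=> [Fs|Ffs].
  exact: (cvg_trans (cvg_app f Fs) (@initial_continuous _ _ f s)).
move=> A [_ [[B oB <-] Bs] BA]; apply: (filterS BA).
by apply: Ffs; exact: open_nbhs_nbhs.
Qed.

Lemma cvg_prod_topology (I : Type) (T : I -> topologicalType)
    (F : set_system (forall i, T i)) (f : forall i, T i) : Filter F ->
  F --> (f : prod_topology T) <-> forall i, g i @[g --> F] --> f i.
Proof.
move=> FF; split=> [/cvg_sup Ff i|Ff].
  by have := Ff i; rewrite cvg_initial.
by apply/cvg_sup => i; apply/cvg_initial; exact: Ff.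
Qed.

Context {R : realType}.

Lemma continuous_borel (X : ptopologicalType) (phi : X -> R) : continuous phi ->
  measurable_fun setT (phi : borel X -> R).
Proof.
move=> /continuousP cphi; apply: (measurability _ (RGenOpens.measurableE R)).
move=> _ [_ [a [b ->]] <-]; rewrite setTI; apply: sub_sigma_algebra.
by apply: cphi; exact: interval_open.
Qed.

Lemma cvg_Delta (X : ptopologicalType) (T : Type) (F : set_system T)
    (m : T -> Delta R X) (l : Delta R X) : Filter F ->
  m a @[a --> F] --> l <->
  forall phi : X -> R, continuous phi -> (exists M : R, forall x, `|phi x| <= M) ->
    \int[\val (m a)]_x phi x @[a --> F] --> \int[\val l]_x phi x.
Proof.
move=> FF; split=> [ml phi cphi bphi|h].
  have p : phi \in @bounded_continuous R X by apply/mem_set; split.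
  move/cvg_initial : ml => /cvg_prod_topology/(_ (exist _ phi p)).
  exact.
apply/cvg_initial/cvg_prod_topology => -[phi p].
by have [cphi bphi] := set_mem p; exact: h.
Qed.

Context {K : finType} {hK : (1 < #|K|)%N}.

Lemma integral_law (X : ptopologicalType) (f : triple hK -> X) (P : info R hK) (phi : X -> R) :
  continuous phi -> (exists M : R, forall x, `|phi x| <= M) ->
  \int[\val (law f P)]_x phi x = Ex P (fun w => phi (f w)).
Proof.
move=> cphi [M phiM]; rewrite /Ex /Rintegral; congr fine.
have mf := triple_measurable_fun f.
rewrite (eq_measure_integral (pushforward P (f : triple hK -> borel X))); last first.
  by move=> A mA _; exact: lawE.
rewrite integral_pushforward ?preimage_setT//.
- apply/measurable_EFinP; exact: continuous_borel.
- by apply: bounded_integrable; exists M.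
Qed.

Lemma integral_mz P (phi : state hK * Theta R hK * Theta R hK -> R) :
  continuous phi -> (exists M : R, forall x, `|phi x| <= M) ->
  \int[\val (mz P)]_x phi x =
  Ex P (fun w => phi (w.1.1, hierarchy P true w.1.2, hierarchy P false w.2)).
Proof. exact: integral_law. Qed.

End Topology.

(** * From convergence of statistics to weak convergence of hierarchies *)

Section StatisticsToWeak.
Context {R : realType} {K : finType} {hK : (1 < #|K|)%N}.
Notation process := (@process R K hK).
Variable u : info R hK.

Lemma stat_min b o (X Y : process) : stat b o X -> stat b o Y ->
  stat b o (fun v w => Num.min (X v w) (Y v w)).
Proof.
move=> sX sY; have := stat_opp (stat_max (stat_opp sX) (stat_opp sY)); congr stat.
by apply/funext => v; apply/funext => w; rewrite -oppr_min opprK.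
Qed.

(** The sets where some statistic positive at [(u, w0)] is positive act as neighbourhoods of that
    point. The structure varies along with the triple, so that views in different structures can be
    compared; minima of statistics give intersections. *)
Definition near_stat (o : option bool) (w0 : triple hK) : set_system (info R hK * triple hK) :=
  [set A | exists2 X, stat true o X & 0 < X u w0 /\ forall v w, 0 < X v w -> A (v, w)].

Global Instance near_stat_filter o w0 : Filter (near_stat o w0).
Proof.
split.
- by exists (fun _ _ => 1); [exact: stat_cst|].
- move=> A B [X sX [X0 XA]] [Y sY [Y0 YB]].
  exists (fun v w => Num.min (X v w) (Y v w)); first exact: stat_min.
  split=> [|v w]; first by rewrite lt_min X0.
  by rewrite lt_min => /andP[/XA ? /YB].
- by move=> A B AB [X sX [X0 XA]]; exists X => //; split=> // v w /XA; exact: AB.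
Qed.

Lemma near_stat_joint i w0 : near_stat None w0 `=>` near_stat (Some i) w0.
Proof. by move=> A [X sX XA]; exists X => //; exact: stat_joint sX. Qed.

(** The bump [e - |X - X u w0|] is itself a statistic. *)
Lemma cvg_near_stat o w0 X : stat true o X -> X p.1 p.2 @[p --> near_stat o w0] --> X u w0.
Proof.
move=> sX; apply/cvgrPdist_lt => e e0.
exists (fun v w => e - `|X v w - X u w0|).
  by apply: stat_sub; [exact: stat_cst|apply/stat_norm/stat_sub => //; exact: stat_cst].
split=> [|v w]; first by rewrite subrr normr0 subr0.
by rewrite subr_gt0 distrC.
Qed.

Section Approximation.
Variables (o : option bool) (Z : topologicalType) (f : info R hK * triple hK -> Z).
Hypothesis cvg_f : forall w0, f p @[p --> near_stat o w0] --> f (u, w0).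

(* A maximum of scaled bump statistics minorizes phi o f everywhere and is
   tight at the given points. *)
Lemma stat_minorant (phi : Z -> R) (B e : R) (s : seq (triple hK)) :
  continuous phi -> (forall z, `|phi z| <= B) -> 0 < e ->
  exists2 X, stat true o X & [/\ forall v w, - B <= X v w,
    forall v w, X v w <= phi (f (v, w)) & {in s, forall w, phi (f (u, w)) - e <= X u w}].
Proof.
move=> cphi phiB e0.
have phi_ge z : - B <= phi z by have := phiB z; rewrite ler_norml => /andP[].
elim: s => [|w0 s [X sX [XB Xphi Xs]]].
  by exists (fun _ _ => - B); [exact: stat_cst|].
have cf : phi (f p) @[p --> near_stat o w0] --> phi (f (u, w0)).
  by apply: continuous_cvg; [exact: cphi|exact: cvg_f].
have [Y sY [Y0 Yphi]] : near_stat o w0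
    [set p | phi (f (u, w0)) - e <= phi (f p)].
  move/cvgrPdist_le : cf => /(_ _ e0); apply: filterS => p /=.
  by rewrite ler_norml; lra.
(* The height of the required bump above the floor [-B]; if it is not positive, the floor alone
   suffices at [w0]. *)
pose a := phi (f (u, w0)) - e + B.
have [a0|a0] := leP a 0.
  exists X => //; split=> // w; rewrite inE => /predU1P[->|]; last exact: Xs.
  by apply: le_trans (XB u w0); move: a0; rewrite /a; lra.
(* The statistic [Y] is normalized to 1 at [w0] and truncated between 0 and 1: the bump reaches
   height [a] at [w0] and vanishes wherever [Yphi] says nothing. *)
exists (fun v w => Num.max (X v w) (- B + a * Num.max 0 (Num.min 1 ((Y u w0)^-1 * Y v w)))).
  apply: stat_max => //; apply: stat_add; first exact: stat_cst.
  apply: stat_scale; apply: stat_max; first exact: stat_cst.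
  by apply: stat_min; [exact: stat_cst|exact: stat_scale].
split=> [v w|v w|w].
- by rewrite le_max XB.
- rewrite ge_max Xphi /=.
  have [Yvw|Yvw] := ltP 0 (Y v w).
    have := Yphi v w Yvw => /= h.
    apply: (@le_trans _ _ (- B + a)); last by rewrite /a; lra.
    rewrite lerD2l; apply: ler_piMr; first exact: ltW.
    by rewrite ge_max ler01 ge_min lexx.
  rewrite max_l ?mulr0 ?addr0//.
  by rewrite ge_min mulr_ge0_le0 ?orbT// invr_ge0 ltW.
- rewrite inE le_max => /predU1P[->|/Xs -> //].
  rewrite mulVf ?gt_eqF// minxx max_r ?ler01// mulr1 /a.
  by apply/orP; right; lra.
Qed.

(** Applied to [phi] and its opposite, lower bounds suffice; they come from a minorant tight on a
    finite box of large mass. The measures [P_] are kept apart from the structures [v_] in which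
    statistics are computed, so that conditional laws are covered. *)
Lemma cvg_stat_weak (T : Type) (F : set_system T) (v_ P_ : T -> info R hK) (P0 : info R hK) :
  Filter F ->
  (forall X, stat true o X -> Ex (P_ a) (X (v_ a)) @[a --> F] --> Ex P0 (X u)) ->
  forall phi : Z -> R, continuous phi -> (exists M : R, forall z, `|phi z| <= M) ->
  Ex (P_ a) (fun w => phi (f (v_ a, w))) @[a --> F] --> Ex P0 (fun w => phi (f (u, w))).
Proof.
move=> FF cvX.
suff lower (phi : Z -> R) : continuous phi -> (exists M : R, forall z, `|phi z| <= M) ->
    forall e : R, 0 < e -> \forall a \near F,
      Ex P0 (fun w => phi (f (u, w))) - e <= Ex (P_ a) (fun w => phi (f (v_ a, w))).
  move=> phi cphi bphi; apply/cvgrPdist_le => e e0.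
  have bphi' : exists M : R, forall z, `|- phi z| <= M.
    by have [M hM] := bphi; exists M => z; rewrite normrN.
  have cphi' : continuous (fun z => - phi z) by move=> z; apply: cvgN; exact: cphi.
  have ExN P v : Ex P (fun w => - phi (f (v, w))) = - Ex P (fun w => phi (f (v, w))).
    have [M hM] := bphi; rewrite -mulN1r -ExZ; last by exists M.
    by apply: eq_Ex => w; rewrite mulN1r.
  near=> a; rewrite ler_norml.
  have : Ex P0 (fun w => phi (f (u, w))) - e <= Ex (P_ a) (fun w => phi (f (v_ a, w))).
    by near: a; exact: lower.
  have : Ex P0 (fun w => - phi (f (u, w))) - e <= Ex (P_ a) (fun w => - phi (f (v_ a, w))).
    by near: a; exact: (lower (fun z => - phi z)).
  by rewrite !ExN; lra.
move=> cphi [B phiB] e e0.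
have B0 : 0 <= B by exact: le_trans (normr_ge0 _) (phiB (f (u, point))).
(* The error [e] is shared out as [e / 6] on the box, at most [2 * B] times the mass outside it,
   hence [2 * e / 3], and [e / 6] for the convergence of the statistic. *)
have d0 : 0 < e / (3 * (B + 1)) by rewrite divr_gt0// mulr_gt0// ltr_wpDl.
have e3 : 0 < e / 3 by lra.
have [N _ /(_ N (leqnn _)) boxN] := box_eventually P0 d0.
pose s := pmap (@pickle_inv (triple hK)) (iota 0 N).
have e6 : 0 < e / 6 by lra.
have [X sX [XB Xphi Xs]] := stat_minorant s cphi phiB e6.
have pt w : phi (f (u, w)) <= X u w + (e / 6 + 2 * B * ind (~` box N) w).
  rewrite indE in_setC; have [wN|_] := boolP (w \in box N).
    have /Xs : w \in s; last by rewrite mulr0; lra.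
    rewrite mem_pmap; apply/mapP; exists (pickle w); last by rewrite pickleK_inv.
    by rewrite mem_iota; move: wN; rewrite inE.
  have := phiB (f (u, w)); rewrite ler_norml mulr1 => /andP[_]; have := XB u w.
  by move: e6; set x := e / 6 => ? ?; lra.
have bind : bounded (ind (~` box N) : triple hK -> R) by exact: bounded_ind.
have bX v : bounded (X v) by exact: stat_bounded_at sX.
have b1 : bounded (fun w : triple hK => e / 6 + 2 * B * ind (~` box N) w).
  by apply: boundedD; [exact: bounded_cst|apply: boundedM => //; exact: bounded_cst].
have E0 : Ex P0 (fun w => phi (f (u, w))) <=
    Ex P0 (X u) + (e / 6 + 2 * B * Ex P0 (ind (~` box N))).
  rewrite -[X in _ + (X + _)](Ex_cst P0) -ExZ// -!ExD//.
  - apply: Ex_le => //; first by exists B.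
    by apply: boundedD => //; exact: bX.
  - exact: bounded_cst.
  - by apply: boundedM => //; exact: bounded_cst.
have E1 : 2 * B * Ex P0 (ind (~` box N)) <= 2 * (e / 3).
  rewrite -mulrA ler_pM2l//; apply: le_trans (ler_wpM2l B0 boxN) _.
  rewrite (_ : B * _ = (e / 3) * (B / (B + 1))).
    apply: ler_piMr; first exact: ltW.
    by rewrite ler_pdivrMr ?ltr_wpDl// mul1r lerDl.
  by field; rewrite gt_eqF// ltr_wpDl.
have := cvX X sX; move/cvgrPdist_le => /(_ _ e6); apply: filterS => a.
have E2 : Ex (P_ a) (X (v_ a)) <= Ex (P_ a) (fun w => phi (f (v_ a, w))).
  by apply: Ex_le => //; exists B.
by rewrite ler_norml; lra.
Unshelve. all: by end_near. Qed.

End Approximation.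

(** By induction the opponent's view converges at every triple, so [cvg_stat_weak] applies to player
    [i]'s conditional laws: conditional expectations of the opponent's statistics are statistics of
    [i], and these converge along the filter. *)
Lemma cvg_view n i w0 :
  (view p.1 n i p.2 : level R hK n) @[p --> near_stat (Some i) w0] --> view u n i w0.
Proof.
elim: n i w0 => [|n IH] i w0.
  move=> A /= /(_ _ erefl) Aw0.
  exists (fun v w => (w.1.1 == w0.1.1)%:R * 1).
    by apply: (stat_state (fun k : K => (k == w0.1.1)%:R)); exact: stat_cst.
  split=> [|v w]; first by rewrite eqxx mulr1.
  by rewrite mulr1 ltr0n lt0b => /eqP /= ->.
suff law_cvg : law (view p.1 n (~~ i)) (cond p.1 i (signal i p.2))
    @[p --> near_stat (Some i) w0] --> law (view u n (~~ i)) (cond u i (signal i w0)).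
  exact: (cvg_pair (IH i w0) law_cvg).
apply/cvg_Delta => phi cphi bphi.
rewrite integral_law//; under eq_fun do rewrite integral_law//.
apply: (@cvg_stat_weak _ _ _ (IH (~~ i)) _ _ fst
  (fun p => cond p.1 i (signal i p.2))) => // X sX.
exact: (@cvg_near_stat _ w0 _ (stat_belief true sX)).
Qed.

Lemma cvg_hierarchy i w0 : hierarchy p.1 i (signal i p.2) @[p --> near_stat (Some i) w0]
  --> hierarchy u i (signal i w0).
Proof.
apply/cvg_initial/cvg_prod_topology => n.
have := @cvg_view n.+1 i w0; move/(cvg_comp _ _) => /(_ _ snd); apply.
exact: cvg_snd.
Qed.

Lemma cvg_stat_mz (u_ : nat -> info R hK) :
  (forall X, stat true None X -> Ex (u_ n) (X (u_ n)) @[n --> \oo] --> Ex u (X u)) ->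
  mz (u_ n) @[n --> \oo] --> mz u.
Proof.
move=> cvX; apply/cvg_Delta => phi cphi bphi.
rewrite integral_mz//; under eq_fun do rewrite integral_mz//.
apply: (@cvg_stat_weak None (state hK * Theta R hK * Theta R hK)%type
  (fun p => (p.2.1.1, hierarchy p.1 true p.2.1.2, hierarchy p.1 false p.2.2))) => // w0.
have joint i (Y : topologicalType) (h : info R hK * triple hK -> Y) (y : Y) :
    h p @[p --> near_stat (Some i) w0] --> y -> h p @[p --> near_stat None w0] --> y.
  by apply: cvg_trans; apply: cvg_app; exact: near_stat_joint.
have h0 := joint _ _ _ _ (@cvg_view 0 true w0).
have h1 := joint _ _ _ _ (@cvg_hierarchy true w0).
have h2 := joint _ _ _ _ (@cvg_hierarchy false w0).
exact: (cvg_pair (cvg_pair h0 h1) h2).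
Qed.

End StatisticsToWeak.

(** * From weak convergence of hierarchies to convergence of statistics *)

Section WeakToStatistics.
Context {R : realType} {K : finType} {hK : (1 < #|K|)%N}.
Notation process := (@process R K hK).

Lemma norm_integral_le (X : ptopologicalType) (m : Delta R X) (phi : X -> R) (M : R) :
  continuous phi -> (forall x, `|phi x| <= M) -> `|\int[\val m]_x phi x| <= M.
Proof.
move=> cphi phiM; have mphi := continuous_borel cphi.
have fin : (\val m setT < +oo)%E by rewrite probability_setT ltry.
have int (f : borel X -> R) : measurable_fun setT f -> (forall x, `|f x| <= M) ->
    (\val m).-integrable setT (EFin \o f).
  move=> mf fM; apply: measurable_bounded_integrable => //.
  by exists M; split; [exact: num_real|move=> N MN x _; exact: le_trans (fM x) (ltW MN)].
have M0 : 0 <= M by exact: le_trans (normr_ge0 _) (phiM point).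
apply: (le_trans (le_normr_Rintegral measurableT (int _ mphi phiM))).
rewrite -[leRHS]mulr1 -[X in _ * X](_ : fine (\val m setT) = 1); last first.
  by rewrite probability_setT.
rewrite -Rintegral_cst//; apply: le_Rintegral => //.
- apply: int => [|x]; last by rewrite normr_id.
  exact: measurableT_comp.
- by apply: int => // x; rewrite ger0_norm.
Qed.

(** The function [phi] is the same for all information structures, so the expectation of [X] is one
    fixed weakly continuous functional of the law of [f]. *)
Definition factors (Z : topologicalType) (f : info R hK -> triple hK -> Z) (X : process) :=
  exists phi : Z -> R, [/\ continuous phi, exists M : R, forall z, `|phi z| <= M &
    forall v w, X v w = phi (f v w)].

Section Closure.
Variables (Z : topologicalType) (f : info R hK -> triple hK -> Z).

Lemma factors_cst c : factors f (fun _ _ => c).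
Proof. by exists (fun=> c); split=> //; [exact: cst_continuous|exists `|c|]. Qed.

Lemma factors_add X Y : factors f X -> factors f Y -> factors f (fun v w => X v w + Y v w).
Proof.
move=> [phi [cphi [M hM] Xphi]] [psi [cpsi [N hN] Ypsi]].
exists (fun z => phi z + psi z); split=> [z||v w]; last by rewrite Xphi Ypsi.
  by apply: cvgD; [exact: cphi|exact: cpsi].
by exists (M + N) => z; rewrite (le_trans (ler_normD _ _))// lerD.
Qed.

Lemma factors_mul X Y : factors f X -> factors f Y -> factors f (fun v w => X v w * Y v w).
Proof.
move=> [phi [cphi [M hM] Xphi]] [psi [cpsi [N hN] Ypsi]].
exists (fun z => phi z * psi z); split=> [z||v w]; last by rewrite Xphi Ypsi.
  by apply: cvgM; [exact: cphi|exact: cpsi].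
by exists (M * N) => z; rewrite normrM ler_pM.
Qed.

Lemma factors_norm X : factors f X -> factors f (fun v w => `|X v w|).
Proof.
move=> [phi [cphi [M hM] Xphi]]; exists (fun z => `|phi z|); split=> [z||v w].
- by apply: cvg_norm; exact: cphi.
- by exists M => z; rewrite normr_id.
- by rewrite Xphi.
Qed.

(** The maximum is half of the sum plus the absolute difference. *)
Lemma factors_max X Y : factors f X -> factors f Y ->
  factors f (fun v w => Num.max (X v w) (Y v w)).
Proof.
move=> fX fY; have := factors_mul (factors_cst 2^-1) (factors_add (factors_add fX fY)
  (factors_norm (factors_add fX (factors_mul (factors_cst (-1)) fY)))).
congr factors; apply/funext => v; apply/funext => w.
by rewrite maxr_absE mulN1r mulrC.
Qed.

Lemma factors_state (k : Z -> state hK) (g : K -> R) : continuous k ->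
  (forall v w, k (f v w) = w.1.1) -> factors f (fun v w => g w.1.1).
Proof.
move=> ck kf; exists (fun z => g (k z)); split=> [z||v w]; last by rewrite kf.
- apply: (@continuous_comp _ _ _ k (fun x : state hK => g x)); first exact: ck.
  move=> A /nbhs_singleton gA; have h : [set k z] `<=` g @^-1` A by move=> y ->.
  exact: h.
- exists (\sum_x `|g x|) => z; rewrite (bigD1 (k z : K))//= lerDl sumr_ge0//.
Qed.

End Closure.

Fixpoint level_state n : level R hK n -> state hK :=
  match n with 0 => id | n'.+1 => fun x => level_state x.1 end.

Lemma level_state_continuous n : continuous (@level_state n).
Proof.
elim: n => [|n IH] x; first exact: cvg_id.
apply: (@continuous_comp _ _ _ fst (@level_state n)); last exact: IH.
exact: cvg_fst.
Qed.

Lemma level_state_view v n i w : level_state (view v n i w) = w.1.1.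
Proof. by elim: n => [//|n IH] /=. Qed.

Fixpoint level_of n (p : state hK * beliefs R hK) : level R hK n :=
  match n with 0 => p.1 | n'.+1 => (level_of n' p, p.2 n') end.

Lemma level_of_continuous n : continuous (level_of n).
Proof.
elim: n => [|n IH] x; first exact: cvg_fst.
have h : p.2 @[p --> x] --> x.2 by exact: cvg_snd.
have hn : p.2 n @[p --> x] --> x.2 n by move/cvg_prod_topology : h => /(_ n).
exact: (cvg_pair (IH x) hn).
Qed.

(** A statistic involves finitely many orders of belief. A conditional expectation raises the order
    by one and is continuous in the next belief, by definition of the weak topology. All large [n]
    are allowed so that two statistics can share one order. *)
Lemma stat_level b i X : stat b (Some i) X ->
  exists N, forall n, (N <= n)%N -> factors (fun v => view v n i) X.
Proof.
move=> sX; suff H o Y : stat b o Y -> forall j, o = Some j ->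
    exists N, forall n, (N <= n)%N -> factors (fun v => view v n j) Y by exact: (H _ _ sX).
move=> {sX}; elim=> {b o Y} [b o c|b o Y Y' _ hY _ hY'|b o c Y _ hY|b o Y Y' _ hY _ hY'|
  o f Y _ hY|b k Y _ hY|//] j oj.
- by exists 0%N => n _; exact: factors_cst.
- have [N hN] := hY j oj; have [N' hN'] := hY' j oj; exists (maxn N N') => n.
  by rewrite geq_max => /andP[/hN ? /hN' ?]; exact: factors_add.
- have [N hN] := hY j oj; exists N => n /hN fY.
  exact: (factors_mul (factors_cst _ c) fY).
- have [N hN] := hY j oj; have [N' hN'] := hY' j oj; exists (maxn N N') => n.
  by rewrite geq_max => /andP[/hN ? /hN' ?]; exact: factors_max.
- have [N hN] := hY j oj; exists N => n /hN fY; apply: factors_mul => //.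
  apply: (factors_state _ (@level_state_continuous n)) => v w.
  exact: level_state_view.
- move: oj => [<-] {j}; have [N hN] := hY _ erefl; exists N.+1 => -[//|n].
  rewrite ltnS => /hN[phi [cphi bphi Yphi]].
  exists (fun x : (level R hK n * Delta R (level R hK n))%type => \int[\val x.2]_z phi z); split=> [x||v w].
  + have h : y.2 @[y --> x] --> x.2 by exact: cvg_snd.
    by move/cvg_Delta : h; exact.
  + have [M hM] := bphi; exists M => x; exact: norm_integral_le.
  + by rewrite /= integral_law// /condE; apply: eq_Ex => w'; rewrite Yphi.
Qed.

(** A statistic of one player is a function of his view of some finite order, hence of the state and
    his hierarchy; joint statistics combine these by operations preserving [factors]. *)
Lemma stat_mz b o X : stat b o X -> factors
  (fun v w => (w.1.1 : state hK, hierarchy v true w.1.2, hierarchy v false w.2)) X.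
Proof.
have one b' i Y : stat b' (Some i) Y -> factors
    (fun v w => (w.1.1 : state hK, hierarchy v true w.1.2, hierarchy v false w.2)) Y.
  move=> /stat_level[N /(_ N (leqnn _))[phi [cphi [M hM] Yphi]]].
  pose k (z : state hK * Theta R hK * Theta R hK) : state hK * beliefs R hK :=
    (z.1.1, \val (if i then z.1.2 else z.2)).
  exists (fun z => phi (level_of N (k z))); split=> [z||v w].
  - have c2 : continuous (fun z => level_of N (k z)).
      move=> {}z; apply: (@continuous_comp _ _ _ k (level_of N)); last exact: level_of_continuous.
      have f1 : z'.1 @[z' --> z] --> z.1 by exact: cvg_fst.
      have h1 : z'.1.1 @[z' --> z] --> z.1.1 by exact: (cvg_comp _ _ f1 cvg_fst).
      have h2 : z'.1.2 @[z' --> z] --> z.1.2 by exact: (cvg_comp _ _ f1 cvg_snd).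
      have h3 : z'.2 @[z' --> z] --> z.2 by exact: cvg_snd.
      suff h4 : \val (if i then z'.1.2 else z'.2) @[z' --> z] -->
          (\val (if i then z.1.2 else z.2) : beliefs R hK) by exact: (cvg_pair h1 h4).
      by case: (i); [move/cvg_initial : h2|move/cvg_initial : h3].
    by apply: (@continuous_comp _ _ _ (fun z => level_of N (k z)) phi); [exact: c2|exact: cphi].
  - by exists M.
  - rewrite Yphi; congr phi; rewrite /k {k Yphi hM cphi phi}.
    have -> : \val (if i then hierarchy v true w.1.2 else hierarchy v false w.2) =
        belief v i (signal i w) :> beliefs R hK by case: i.
    by elim: N => [//|N IH] /=; rewrite IH.
elim=> {b o X}.
- by move=> *; exact: factors_cst.
- by move=> *; exact: factors_add.
- by move=> b o c X _ fX; exact: (factors_mul (factors_cst _ c) fX).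
- by move=> *; exact: factors_max.
- move=> o g X _ fX; apply: factors_mul => //.
  apply: (factors_state (k := fun z => z.1.1)) => // z.
  have f1 : z'.1 @[z' --> z] --> z.1 by exact: cvg_fst.
  exact: (cvg_comp _ _ f1 cvg_fst).
- by move=> b i X sX _; exact: (one b i _ (stat_belief _ sX)).
- by [].
Qed.

Lemma cvg_mz_stat (u : info R hK) (u_ : nat -> info R hK) b o X :
  mz (u_ n) @[n --> \oo] --> mz u -> stat b o X ->
  Ex (u_ n) (X (u_ n)) @[n --> \oo] --> Ex u (X u).
Proof.
move=> /cvg_Delta cmz /stat_mz[phi [cphi bphi Xphi]].
have e v : Ex v (X v) = \int[\val (mz v)]_x phi x.
  by rewrite integral_mz//; exact: eq_Ex.
by rewrite e; under eq_fun do rewrite e; exact: cmz.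
Qed.

End WeakToStatistics.

(** * Transfer of strategies *)

Section Classes.
Context {R : realType} {K : finType} {hK : (1 < #|K|)%N}.
Notation process := (@process R K hK).
Variables (u : info R hK) (i : bool).

(** A triple in which either player holds [c]; it turns a statistic of one player into a function of
    his signal. *)
Definition both (c : nat) : triple hK := (point, c, c).

Lemma signal_both j c : signal j (both c) = c.
Proof. by case: j. Qed.

Lemma stat_both (v : info R hK) (X : process) w : stat false (Some i) X -> X v w = X v (both (signal i w)).
Proof. by move=> sX; apply: (stat_signal sX); rewrite signal_both. Qed.

Definition same_stats (c c' : nat) :=
  forall X : process, stat false (Some i) X -> X u (both c) = X u (both c').

(** The choice made by [xget] depends on the class of [c] only, so this is a canonical
    representative. *)
Definition rep (c : nat) : nat := xget 0%N [set c' | same_stats c c'].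

Lemma same_rep c : same_stats c (rep c).
Proof. by apply: (@xgetPex _ 0%N [set c' | same_stats c c']); exists c. Qed.

Lemma rep_eq c c' : same_stats c c' -> rep c = rep c'.
Proof.
move=> cc'; congr (xget _ _); apply/seteqP; split=> x h X sX.
  by rewrite -cc'// h.
by rewrite cc'// h.
Qed.

Lemma rep_rep c : rep (rep c) = rep c.
Proof. by apply/esym/rep_eq; exact: same_rep. Qed.

Lemma stat_rep (X : process) w : stat false (Some i) X -> X u w = X u (both (rep (signal i w))).
Proof. by move=> sX; rewrite (stat_both u w sX) same_rep. Qed.

(** The representatives below a cutoff are finitely many, and by [nat_tail] the remaining classes
    have small mass. *)
Lemma rep_cover (e : R) : 0 < e -> exists (A : finType) (r : A -> nat),
  [/\ injective r, forall a, rep (r a) = r a &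
    Ex u (ind [set w | forall a, r a <> rep (signal i w)]) <= e].
Proof.
move=> e0; have [N hN] := nat_tail u (fun w => rep (signal i w)) e0.
exists {c : 'I_N | rep c == c}, (fun a => val (val a)); split.
- by move=> a b /val_inj/val_inj.
- by move=> a; apply/eqP; exact: (valP a).
apply: le_trans hN; apply: Ex_le; [exact: bounded_ind..|] => w.
rewrite !indE ler_nat; have [|//] := boolP (_ \in _); rewrite inE /= => h.
rewrite mem_set//= leqNgt; apply/negP => cN.
have p : rep (Ordinal cN) == Ordinal cN :> nat by rewrite /= rep_rep.
exact: (h (exist _ (Ordinal cN) p)).
Qed.

Section Bumps.
Variables (A Q : finType) (r : A -> nat) (q : Q -> process) (d : R).
Hypothesis r_inj : injective r.
Hypothesis rep_r : forall a, rep (r a) = r a.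
Hypothesis stat_q : forall j, stat false (Some i) (q j).
Hypothesis d0 : 0 < d.

(** Distinct classes are separated by statistics, which gives tents equal to 1 at their own class
    and 0 at the others. Subtracting the other tents makes the supports disjoint, whence the sum is
    at most 1. *)
Lemma bumps : exists b : A -> process,
  [/\ forall a, stat false (Some i) (b a),
      forall a v w, 0 <= b a v w, forall v w, \sum_a b a v w <= 1,
      forall a a', b a u (both (r a')) = (a == a')%:R &
      forall a j v w, b a v w * `|q j v w - q j u (both (r a))| <= d * b a v w].
Proof.
(* A separating statistic for each pair of classes; on the diagonal it is a dummy. *)
have /choice[S hS] : forall p : A * A, exists S, stat false (Some i) S /\
    (p.1 != p.2 -> S u (both (r p.1)) != S u (both (r p.2))).
  move=> [a a'] /=; have [<-|aa'] := eqVneq a a'.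
    by exists (fun _ _ => 0); split=> //; exact: stat_cst.
  apply: contrapT => /forallNP h; move/eqP: aa'; apply; apply: r_inj.
  rewrite -rep_r -[RHS]rep_r; apply: rep_eq => X sX; apply: contrapT => XX'.
  by apply: (h X); split=> // _; exact/eqP.
have stat_S p : stat false (Some i) (S p) by case: (hS p).
pose gap a a' : R := `|S (a, a') u (both (r a')) - S (a, a') u (both (r a))|.
have gap0 a a' : a' != a -> 0 < gap a a'.
  move=> a'a; rewrite normr_gt0 subr_eq0; have [_ /=] := hS (a, a').
  by rewrite eq_sym a'a eq_sym => /(_ isT).
pose dev (X : process) a : process := fun v w => `|X v w - X u (both (r a))|.
have stat_dev X a : stat false (Some i) X -> stat false (Some i) (dev X a).
  by move=> sX; apply/stat_norm/stat_sub => //; exact: stat_cst.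
(* Dividing by [gap] makes the tent vanish at each other class, and dividing by [d] makes it vanish
   where some [q j] deviates by [d] or more. *)
pose tent a : process := fun v w => Num.max 0 (1
  - \sum_(a' | a' != a) (gap a a')^-1 * dev (S (a, a')) a v w
  - \sum_j d^-1 * dev (q j) a v w).
have stat_tent a : stat false (Some i) (tent a).
  apply: stat_max; first exact: stat_cst.
  apply: stat_sub; first apply: stat_sub; first exact: stat_cst.
    by apply: stat_sum => a'; apply: stat_scale; exact: stat_dev.
  by apply: stat_sum => a'; apply: stat_scale; exact: stat_dev.
have dev0 X a v w : 0 <= dev X a v w by exact: normr_ge0.
have term1 a a' v w : 0 <= (gap a a')^-1 * dev (S (a, a')) a v w.
  by rewrite mulr_ge0// invr_ge0 normr_ge0.
have term2 a j v w : 0 <= d^-1 * dev (q j) a v w by rewrite mulr_ge0// invr_ge0 ltW.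
have tent0 a v w : 0 <= tent a v w by rewrite le_max lexx.
have tent1 a v w : tent a v w <= 1.
  rewrite ge_max ler01 /=.
  have : 0 <= \sum_(a' | a' != a) (gap a a')^-1 * dev (S (a, a')) a v w by exact: sumr_ge0.
  have : 0 <= \sum_j d^-1 * dev (q j) a v w by exact: sumr_ge0.
  by lra.
have devr X a : dev X a u (both (r a)) = 0 by rewrite /dev subrr normr0.
have tentE a a' : tent a u (both (r a')) = (a == a')%:R.
  have [->|aa'] := eqVneq a a'.
    rewrite /tent !big1 => [|a'' _|j _]; rewrite ?devr ?mulr0//.
    by rewrite !subr0 max_r.
  apply/max_idPl; rewrite (bigD1 a')//=; last by rewrite eq_sym.
  have -> : dev (S (a, a')) a u (both (r a')) = gap a a' by [].
  rewrite mulVf ?gt_eqF ?gap0//; last by rewrite eq_sym.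
  set x := \sum_(_ | _) _; set y := \sum_j _.
  have : 0 <= x by exact: sumr_ge0.
  have : 0 <= y by exact: sumr_ge0.
  by lra.
have tentq a j v w : 0 < tent a v w -> dev (q j) a v w <= d.
  rewrite lt_max ltxx /= (bigD1 j)//=.
  set x := \sum_(_ | _) _; set y := \sum_(_ | _) _.
  have : 0 <= x by exact: sumr_ge0.
  have : 0 <= y by exact: sumr_ge0.
  move=> y0 x0 h; have : d^-1 * dev (q j) a v w <= 1 by lra.
  by rewrite mulrC ler_pdivrMr// mul1r.
exists (fun a v w => Num.max 0 (tent a v w - \sum_(a' | a' != a) tent a' v w)).
have le_tent a v w :
    Num.max 0 (tent a v w - \sum_(a' | a' != a) tent a' v w) <= tent a v w.
  by rewrite ge_max tent0 /= gerDl oppr_le0 sumr_ge0.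
split.
- move=> a; apply: stat_max; first exact: stat_cst.
  by apply: stat_sub => //; exact: stat_sum.
- by move=> a v w; rewrite le_max lexx.
- move=> v w; pose b a := Num.max 0 (tent a v w - \sum_(a' | a' != a) tent a' v w).
  have [/forallP b0|/forallPn[a]] := boolP [forall a, b a == 0].
    by rewrite big1// => a _; exact/eqP/b0.
  rewrite neq_lt lt_max !ltxx /= ltNge le_max lexx /= => ba.
  rewrite -[X in X <= _]/(\sum_a b a) (bigD1 a)//= big1 ?addr0.
    by apply: le_trans (tent1 a v w); exact: le_tent.
  move=> a' a'a; apply/max_idPl; rewrite subr_le0 (bigD1 a)//=; last by rewrite eq_sym.
  move: ba; rewrite subr_gt0 (bigD1 a')//=.
  set x := \sum_(_ | _) _; set y := \sum_(_ | _) _.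
  have : 0 <= x by exact: sumr_ge0.
  have : 0 <= y by exact: sumr_ge0.
  by lra.
- move=> a a'; under eq_bigr do rewrite tentE; rewrite tentE.
  have [<-|aa'] := eqVneq a a'.
    by rewrite big1 ?subr0 ?max_r// => a'' /negPf ->.
  by apply/max_idPl; rewrite sub0r oppr_le0 sumr_ge0.
- move=> a j v w; have := le_tent a v w.
  set y := Num.max 0 _ => yt.
  have [y0|y0] := leP y 0.
    have -> : y = 0 by apply/le_anti; rewrite y0 le_max lexx.
    by rewrite mul0r mulr0.
  by rewrite mulrC ler_pM2r// tentq// (lt_le_trans y0).
Qed.

End Bumps.
End Classes.

Section Transfer.
Context {R : realType} {K : finType} {hK : (1 < #|K|)%N}.
Notation process := (@process R K hK).

Lemma stat_weaken b o (X : process) : stat b o X -> stat true o X.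
Proof.
elim=> {b o X} [b o c|b o X Y _ hX _ hY|b o c X _ hX|b o X Y _ hX _ hY|o f X _ hX|b i X sX _|
  b i X _ hX].
- exact: stat_cst.
- exact: stat_add.
- exact: stat_scale.
- exact: stat_max.
- exact: stat_state.
- exact: stat_belief.
- exact: stat_joint hX.
Qed.

Lemma pair_norm_le (A B : finType) (p : A -> R) (q : B -> R) (z : A -> B -> R) C :
  dist p -> dist q -> (forall a b, `|z a b| <= C) ->
  `|\sum_a \sum_b p a * q b * z a b| <= C.
Proof.
move=> hp hq zC; under eq_bigr do (under eq_bigr do rewrite -mulrA; rewrite -mulr_sumr).
by apply: dist_norm_le => // a; exact: dist_norm_le.
Qed.

Lemma strategy_norm_le (A : finType) (s : nat -> A -> R) c x : strategy s -> `|s c x| <= 1.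
Proof. by move=> /(_ c) ds; rewrite ger0_norm ?dist_le1//; case: ds. Qed.

(** The first strategy belongs to player [i], whoever that is, so that transfers for the maximizer
    and for the minimizer share one proof. *)
Definition ipay (v : info R hK) (i : bool) (A B : finType) (g : K -> A -> B -> R)
    (s : nat -> A -> R) (t : nat -> B -> R) : R :=
  Ex v (fun w => \sum_x \sum_y s (signal i w) x * t (signal (~~ i) w) y * g w.1.1 x y).

Lemma gpay_swap (v : info R hK) (A B : finType) (g : K -> A -> B -> R) s t :
  gpay v (fun w => g w.1.1) s t = ipay v false (fun k y x => g k x y) t s.
Proof.
apply: eq_Ex => w; rewrite /bilin exchange_big; apply: eq_bigr => y _.
by apply: eq_bigr => x _; rewrite [_ * t _ _]mulrC.
Qed.

Lemma pair_bounded (i : bool) (A B : finType) (g : K -> A -> B -> R) s t :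
  strategy s -> strategy t -> (forall k x y, `|g k x y| <= 1) ->
  bounded (fun w : triple hK =>
    \sum_x \sum_y s (signal i w) x * t (signal (~~ i) w) y * g w.1.1 x y).
Proof. by move=> hs ht g1; exists 1 => w; exact: pair_norm_le. Qed.

Definition weights (i : bool) (A : finType) (b : A -> process) :=
  [/\ forall a, stat false (Some i) (b a), forall a v w, 0 <= b a v w &
      forall v w, \sum_a b a v w <= 1].

Definition slack (A : finType) (b : A -> process) : process :=
  fun v w => 1 - \sum_a b a v w.

(** The weights may sum to less than 1; the default action [x0] absorbs the rest. *)
Definition mix (X A : finType) (x0 : X) (b : A -> process) (s : A -> X -> R)
    (v : info R hK) (c : nat) (x : X) : R :=
  \sum_a b a v (both c) * s a x + slack b v (both c) * (x == x0)%:R.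

Section Weights.
Variables (i : bool) (A : finType) (b : A -> process).
Hypothesis wb : weights i b.

Lemma slack_ge0 v w : 0 <= slack b v w.
Proof. by case: wb => _ _ b1; rewrite subr_ge0. Qed.

Lemma slack_le1 v w : slack b v w <= 1.
Proof. by case: wb => _ b0 _; rewrite gerBl sumr_ge0. Qed.

Lemma stat_slack : stat false (Some i) (slack b).
Proof.
case: wb => sb _ _; apply: stat_sub; first exact: stat_cst.
exact: stat_sum.
Qed.

Lemma bounded_weight a v : bounded (b a v).
Proof. by case: wb => sb _ _; exact: stat_bounded_at (sb a). Qed.

Lemma bounded_slack v : bounded (slack b v).
Proof. exact: stat_bounded_at stat_slack. Qed.

Lemma mix_strategy (X : finType) (x0 : X) (s : A -> X -> R) v :
  (forall a, dist (s a)) -> strategy (mix x0 b s v).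
Proof.
move=> ds c; case: wb => _ b0 b1; split=> [x|].
  rewrite addr_ge0 ?mulr_ge0 ?slack_ge0 ?ler0n// sumr_ge0// => a _.
  by rewrite mulr_ge0//; case: (ds a).
rewrite big_split /= -mulr_sumr exchange_big /=.
under eq_bigr => a _ do (rewrite -mulr_sumr; have [_ ->] := ds a; rewrite mulr1).
have [_ e] := @dist_point R X x0.
by rewrite e mulr1 /slack addrC subrK.
Qed.

Lemma mixE (X : finType) (x0 : X) (s : A -> X -> R) v w x :
  mix x0 b s v (signal i w) x = \sum_a b a v w * s a x + slack b v w * (x == x0)%:R.
Proof.
case: wb => sb _ _; rewrite /mix (stat_both v w stat_slack); congr (_ + _).
by apply: eq_bigr => a _; rewrite (stat_both v w (sb a)).
Qed.

(** What the opponent of [i] believes jointly about the state and the bump in force for [i]. It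
    determines the payoff of each reply to a [mix], up to the slack. *)
Definition joint_belief (p : K * A) : process :=
  fun v => condE v (signal (~~ i)) (fun w => ((w.1.1 : K) == p.1)%:R * b p.2 v w).

Lemma stat_joint_belief p : stat false (Some (~~ i)) (joint_belief p).
Proof.
case: wb => sb _ _; apply: stat_belief; rewrite negbK.
apply: (stat_state (fun k => (k == p.1)%:R)); exact: stat_weaken (sb p.2).
Qed.

Let bounded_atom p v : bounded (fun w => ((w.1.1 : K) == p.1)%:R * b p.2 v w).
Proof.
by apply: boundedM; [exists 1 => w; rewrite normr_nat lern1 leq_b1|exact: bounded_weight].
Qed.

Lemma joint_belief_ge0 p v w : 0 <= joint_belief p v w.
Proof. by apply: Ex_ge0 => w'; case: wb => _ b0 _; rewrite mulr_ge0// ler0n. Qed.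

Lemma sum_atoms v w (F : K * A -> R) :
  \sum_p ((w.1.1 : K) == p.1)%:R * b p.2 v w * F p = \sum_a b a v w * F (w.1.1 : K, a).
Proof.
transitivity (\sum_(k : K) \sum_a ((w.1.1 : K) == k)%:R * b a v w * F (k, a)).
  by rewrite pair_bigA; apply: eq_bigr => -[].
rewrite (bigD1 (w.1.1 : K))//= [X in _ + X]big1 ?addr0.
  by apply: eq_bigr => a _; rewrite eqxx mul1r.
by move=> k kw; rewrite big1// => a _; rewrite eq_sym (negPf kw) !mul0r.
Qed.

Lemma joint_belief_sum v w : \sum_p joint_belief p v w <= 1.
Proof.
rewrite -Ex_sum//; rewrite -[leRHS](Ex_cst (cond_at v (signal (~~ i)) (signal (~~ i) w))).
apply: Ex_le; [exact: bounded_sum|exact: bounded_cst|] => w'.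
have := sum_atoms v w' (fun=> 1); under eq_bigr do rewrite mulr1.
move=> ->; under eq_bigr do rewrite mulr1.
by case: wb.
Qed.

End Weights.

Section Approximation.
Variables (v : info R hK) (i : bool) (X Y A D : finType) (g : K -> X -> Y -> R).
Variables (b : A -> process) (beta : D -> process) (s : A -> X -> R) (x0 : X).
Variables (c : D -> K * A -> R) (d : R).
Hypotheses (wb : weights i b) (wbeta : weights (~~ i) beta).
Hypothesis g1 : forall k x y, `|g k x y| <= 1.
Hypothesis ds : forall a, dist (s a).
Hypothesis hc : forall e p w,
  beta e v w * `|joint_belief i b p v w - c e p| <= d * beta e v w.
Hypothesis d0 : 0 <= d.

Definition reply (p : K * A) (y : Y) : R := \sum_x s p.2 x * g p.1 x y.

(** The payoff of reply [y] on bump [e], computed from the constants [c] in place of the true joint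
    beliefs; it is independent of the information structure. *)
Definition forecast (e : D) (y : Y) : R := \sum_p c e p * reply p y.

Lemma reply_le1 p y : `|reply p y| <= 1.
Proof. exact: dist_norm_le. Qed.

(** Three moves: [T1] drops the slack of [b]; [T2] conditions on the opponent's signal; [T3] freezes
    joint beliefs on each bump [beta e], at the cost of the slack of [beta] and of [d] for each pair
    of a state and a bump. The result involves [v] only through bumps and replies. *)
Lemma mix_approx (t : nat -> Y -> R) : strategy t ->
  `|ipay v i g (mix x0 b s v) t
    - \sum_e \sum_y Ex v (fun w => beta e v w * t (signal (~~ i) w) y) * forecast e y|
  <= Ex v (slack b v) + Ex v (slack beta v) + #|{: K * A}|%:R * d.
Proof.
move=> ht; pose T y (w : triple hK) := t (signal (~~ i) w) y.
have bT y : bounded (T y).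
  by exists 1 => w; exact: strategy_norm_le.
have bb a : bounded (b a v) by exact: bounded_weight wb a v.
have bbeta e : bounded (beta e v) by exact: bounded_weight wbeta e v.
have bq p : bounded (joint_belief i b p v).
  exact: stat_bounded_at (stat_joint_belief wb p).
pose atom p (w : triple hK) := ((w.1.1 : K) == p.1)%:R * b p.2 v w.
have batom p : bounded (atom p).
  by apply: boundedM => //; exists 1 => w; rewrite normr_nat lern1 leq_b1.
pose T1 w := \sum_y T y w * \sum_p atom p w * reply p y.
pose T2 w := \sum_y T y w * \sum_p joint_belief i b p v w * reply p y.
pose T3 w := \sum_y T y w * \sum_e beta e v w * forecast e y.
have bT1 : bounded T1.
  apply: bounded_sum => y; apply: boundedM => //; apply: bounded_sum => p.
  by apply: boundedM => //; exact: bounded_cst.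
have bT2 : bounded T2.
  apply: bounded_sum => y; apply: boundedM => //; apply: bounded_sum => p.
  by apply: boundedM => //; exact: bounded_cst.
have bT3 : bounded T3.
  apply: bounded_sum => y; apply: boundedM => //; apply: bounded_sum => p.
  by apply: boundedM => //; exact: bounded_cst.
(* The reply depends on the opponent's signal only, so the tower property makes this move exact. *)
have E12 : Ex v T1 = Ex v T2.
  rewrite !Ex_sum; first apply: eq_bigr => y _.
  - have e1 : (fun w => T y w * \sum_p atom p w * reply p y) =
        fun w => \sum_p reply p y * (T y w * atom p w).
      by apply/funext => w; rewrite mulr_sumr; apply: eq_bigr => p _; ring.
    have e2 : (fun w => T y w * \sum_p joint_belief i b p v w * reply p y) =
        fun w => \sum_p reply p y * (T y w * joint_belief i b p v w).
      by apply/funext => w; rewrite mulr_sumr; apply: eq_bigr => p _; ring.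
    rewrite e1 e2 !Ex_sum; first apply: eq_bigr => p _.
    + rewrite !ExZ; [|by apply: boundedM|by apply: boundedM]; congr (_ * _).
      apply: (@tower _ _ _ v _ _ (fun n => t n y) (batom p)); exists 1 => n.
      exact: strategy_norm_le.
    + by move=> p; apply: boundedM; [exact: bounded_cst|exact: boundedM].
    + by move=> p; apply: boundedM; [exact: bounded_cst|exact: boundedM].
  - move=> y; apply: boundedM => //; apply: bounded_sum => p.
    by apply: boundedM => //; exact: bounded_cst.
  - move=> y; apply: boundedM => //; apply: bounded_sum => p.
    by apply: boundedM => //; exact: bounded_cst.
have E3 : Ex v T3 = \sum_e \sum_y Ex v (fun w => beta e v w * T y w) * forecast e y.
  have -> : T3 = fun w => \sum_e \sum_y forecast e y * (beta e v w * T y w).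
    apply/funext => w; rewrite exchange_big; apply: eq_bigr => y _.
    by rewrite mulr_sumr; apply: eq_bigr => e _; ring.
  rewrite Ex_sum; last first.
    move=> e; apply: bounded_sum => y; apply: boundedM; first exact: bounded_cst.
    exact: boundedM.
  apply: eq_bigr => e _; rewrite Ex_sum; last first.
    by move=> y; apply: boundedM; [exact: bounded_cst|exact: boundedM].
  by apply: eq_bigr => y _; rewrite ExZ; [exact: mulrC|exact: boundedM].
have hm := mix_strategy wb x0 v ds.
have bI := pair_bounded i hm ht g1.
have D1 : `|ipay v i g (mix x0 b s v) t - Ex v T1| <= Ex v (slack b v).
  rewrite -ExB//; apply: Ex_norm_le; first exact: boundedB.
    exact: bounded_slack wb v.
  move=> w; rewrite exchange_big /= -sumrB.
  rewrite (eq_bigr (fun y => slack b v w * (T y w * g w.1.1 x0 y))); last first.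
    move=> y _; rewrite (sum_atoms b v w (fun p => reply p y)).
    have -> : \sum_x mix x0 b s v (signal i w) x * t (signal (~~ i) w) y * g w.1.1 x y =
        T y w * \sum_x mix x0 b s v (signal i w) x * g w.1.1 x y.
      by rewrite mulr_sumr; apply: eq_bigr => x _; rewrite /T; ring.
    rewrite -mulrBr mulrCA; congr (_ * _).
    under eq_bigr do rewrite (mixE wb) mulrDl mulr_suml.
    rewrite big_split /= exchange_big /=.
    have -> : \sum_x slack b v w * (x == x0)%:R * g w.1.1 x y = slack b v w * g w.1.1 x0 y.
      rewrite (bigD1 x0)//= eqxx mulr1 big1 ?addr0// => x /negPf ->.
      by rewrite mulr0 mul0r.
    rewrite addrAC (_ : \sum_a \sum_x _ = \sum_a b a v w * reply (w.1.1 : K, a) y).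
      by rewrite subrr add0r.
    by apply: eq_bigr => a _; rewrite mulr_sumr; apply: eq_bigr => x _; rewrite mulrA.
  rewrite -mulr_sumr normrM (ger0_norm (slack_ge0 wb v w)) ler_piMr ?(slack_ge0 wb)//.
  by apply: dist_norm_le => //; exact: ht.
have D2 : `|Ex v T2 - Ex v T3| <= Ex v (slack beta v) + #|{: K * A}|%:R * d.
  rewrite -ExB// -[X in _ + X](Ex_cst v) -ExD; first last.
  - exact: bounded_cst.
  - exact: bounded_slack wbeta v.
  apply: Ex_norm_le; first exact: boundedB.
    by apply: boundedD; [exact: bounded_slack wbeta v|exact: bounded_cst].
  move=> w; rewrite -sumrB; under eq_bigr do rewrite -mulrBr.
  apply: dist_norm_le => [|y]; first exact: ht.
  set H := \sum_p joint_belief i b p v w * reply p y.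
  have H1 : `|H| <= 1.
    rewrite (le_trans (norm_sum_le _ (fun p => reply_le1 p y)))//.
      by move=> p; exact: (joint_belief_ge0 wb).
    by rewrite mulr1 (joint_belief_sum wb).
  have -> : H - \sum_e beta e v w * forecast e y =
      slack beta v w * H + \sum_e beta e v w * (H - forecast e y).
    under [X in _ = _ + X]eq_bigr do rewrite mulrBr.
    by rewrite sumrB -mulr_suml /slack; ring.
  rewrite (le_trans (ler_normD _ _))// lerD//.
    by rewrite normrM (ger0_norm (slack_ge0 wbeta v w)) ler_piMr// (slack_ge0 wbeta).
  rewrite (le_trans (ler_norm_sum _ _ _))//.
  case: wbeta => _ beta0 beta1.
  apply: (@le_trans _ _ (\sum_e beta e v w * (#|{: K * A}|%:R * d))); last first.
    by rewrite -mulr_suml ler_piMl// mulr_ge0.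
  apply: ler_sum => e _; rewrite normrM (ger0_norm (beta0 e v w)) /H /forecast -sumrB.
  apply: (@le_trans _ _ (beta e v w *
      \sum_p `|joint_belief i b p v w - c e p|)).
    rewrite ler_wpM2l// (le_trans (ler_norm_sum _ _ _))//; apply: ler_sum => p _.
    by rewrite -mulrBl normrM ler_piMr// reply_le1.
  rewrite mulr_sumr (le_trans (ler_sum _ (fun p _ => hc e p w)))//.
  by rewrite sumr_const -[X in X <= _]mulr_natl [leRHS]mulrCA [beta e v w * d]mulrC.
rewrite -E3 -[_ - _](subrKA (Ex v T1)) {2}E12 (le_trans (ler_normD _ _))//.
by rewrite -addrA lerD.
Qed.

End Approximation.
End Transfer.

(** * From convergence of statistics to convergence of values *)

Section Convergence.
Context {R : realType} {K : finType} {hK : (1 < #|K|)%N}.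
Notation process := (@process R K hK).
Variable u : info R hK.

Definition class_signal (i : bool) (w : triple hK) : nat := rep u i (signal i w).

Definition class_average (i : bool) (X : Type) (s : nat -> X -> R) (r : nat) (x : X) : R :=
  Ex (cond_at u (class_signal i) r) (fun w => s (signal i w) x).

Lemma class_average_dist i (X : finType) (s : nat -> X -> R) r :
  strategy s -> dist (class_average i s r).
Proof.
move=> hs; split=> [x|]; first by apply: Ex_ge0 => w; case: (hs (signal i w)).
rewrite -Ex_sum; last by move=> x; exists 1 => w; exact: strategy_norm_le.
rewrite -[RHS](Ex_cst (cond_at u (class_signal i) r)); apply: eq_Ex => w.
by case: (hs (signal i w)).
Qed.

(* Against a reply that depends on the opponent's statistics only, player i may
   randomize within classes of signals with the same statistics, since
   conditional expectations of statistics are constant on classes. *)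
Lemma ipay_average i (X Y : finType) (g : K -> X -> Y -> R) s t (T : Y -> process) :
  strategy s -> strategy t -> (forall y, stat false (Some (~~ i)) (T y)) ->
  (forall y w, t (signal (~~ i) w) y = T y u w) ->
  ipay u i g s t = ipay u i g (fun c => class_average i s (rep u i c)) t.
Proof.
move=> hs ht sT tT.
pose W x : process := fun v w => \sum_y g w.1.1 x y * T y v w.
have sW x : stat true (Some (~~ i)) (W x).
  apply: stat_sum => y; apply: (stat_state (fun k => g k x y)).
  exact: stat_weaken (sT y).
have bW x : bounded (W x u) by exact: stat_bounded_at (sW x).
pose V x : process := fun v => condE v (signal i) (W x v).
have sV x : stat false (Some i) (V x) by exact: stat_belief.
have bV x : bounded (V x u) by exact: stat_bounded_at (sV x).
have bVc x : exists B : R, forall c, `|V x u (both c)| <= B.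
  by have [B hB] := bV x; exists B => c; exact: hB.
have payE s' : strategy s' ->
    ipay u i g s' t = \sum_x Ex u (fun w => V x u (both (class_signal i w)) * s' (signal i w) x).
  move=> hs'; have bs' x : bounded (fun w : triple hK => s' (signal i w) x).
    by exists 1 => w; exact: strategy_norm_le.
  transitivity (Ex u (fun w => \sum_x s' (signal i w) x * W x u w)).
    apply: eq_Ex => w; apply: eq_bigr => x _; rewrite mulr_sumr; apply: eq_bigr => y _.
    by rewrite tT; ring.
  rewrite Ex_sum => [|x]; last exact: boundedM.
  apply: eq_bigr => x _.
  rewrite (@tower _ _ _ u _ _ (fun c => s' c x) (bW x)); last first.
    by exists 1 => c; exact: strategy_norm_le.
  by apply: eq_Ex => w; rewrite mulrC -stat_rep.
rewrite !payE//; last by move=> c; exact: class_average_dist.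
apply: eq_bigr => x _.
apply: (@tower _ _ _ u (class_signal i) _ (fun r => V x u (both r))) => //.
by exists 1 => w; exact: strategy_norm_le.
Qed.

Variable u_ : nat -> info R hK.
Hypothesis cvg_stat : forall b o X, stat b o X ->
  Ex (u_ n) (X (u_ n)) @[n --> \oo] --> Ex u (X u).

Lemma transfer i (e : R) : 0 < e -> \forall n \near \oo,
  forall (X Y : finType) (g : K -> X -> Y -> R), (0 < #|X|)%N -> (0 < #|Y|)%N ->
  (forall k x y, `|g k x y| <= 1) ->
  exists (F : (nat -> X -> R) -> nat -> X -> R) (H : (nat -> Y -> R) -> nat -> Y -> R),
    [/\ forall s, strategy s -> strategy (F s), forall t, strategy t -> strategy (H t) &
      forall s t, strategy s -> strategy t ->
        `|ipay u i g s (H t) - ipay (u_ n) i g (F s) t| <= e].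
Proof.
(* The count 13 is 2 + 3 + 2 + 1 + 5, the bounds from [E2], [E3], [E4], [E5] and [E7] in units of
   [e']. *)
move=> e0; pose e' := e / 13; have e'0 : 0 < e' by rewrite divr_gt0.
have [A [r [r_inj rep_r offA]]] := rep_cover u i e'0.
have [D [q [q_inj rep_q offD]]] := rep_cover u (~~ i) e'0.
(* Player [i]'s bumps need only separate classes, so no statistics are controlled and the radius is
   arbitrary; the bumps [beta] of the opponent, built next, must also control the joint beliefs
   about [b]. *)
have [b [sb b0 b1 bE _]] := @bumps _ _ _ u i A void r (fun x => match x with end) 1
  r_inj rep_r (fun x => match x with end) ltr01.
have wb : weights i b by [].
pose d := e' / (#|{: K * A}|%:R + 1).
have d0 : 0 < d by rewrite divr_gt0// ltr_wpDl.
have dN : #|{: K * A}|%:R * d <= e'.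
  rewrite /d mulrCA; apply: ler_piMr; first exact: ltW.
  by rewrite ler_pdivrMr ?ltr_wpDl// mul1r lerDl.
have [beta [sbeta beta0 beta1 betaE betaq]] := @bumps _ _ _ u (~~ i) D _ q
  (joint_belief i b) d q_inj rep_q (stat_joint_belief wb) d0.
have wbeta : weights (~~ i) beta by [].
pose c f p := joint_belief i b p u (both (q f)).
have slack_off j (A' : finType) (r' : A' -> nat) (b' : A' -> process) : weights j b' ->
    (forall a a', b' a u (both (r' a')) = (a == a')%:R) ->
    Ex u (ind [set w | forall a, r' a <> rep u j (signal j w)]) <= e' ->
    Ex u (slack b' u) <= e'.
  move=> wb' b'E; apply: le_trans; apply: Ex_le; first exact: bounded_slack wb' u.
    exact: bounded_ind.
  move=> w; rewrite indE; have [_|] := boolP (_ \in _); first exact: slack_le1 wb' u w.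
  rewrite notin_setE /= => /existsNP[a /contrapT ra].
  rewrite (stat_rep u w (stat_slack wb')) -ra /slack.
  by under eq_bigr do rewrite b'E; rewrite (bigD1 a)//= eqxx big1 ?addr0 ?subrr// => a' /negPf ->.
have slackb := slack_off _ _ _ _ wb bE offA.
have slackbeta := slack_off _ _ _ _ wbeta betaE offD.
have ev_slack j (A' : finType) (b' : A' -> process) : weights j b' -> Ex u (slack b' u) <= e' ->
    \forall n \near \oo, Ex (u_ n) (slack b' (u_ n)) <= 2 * e'.
  move=> wb' s'; have /cvgrPdist_le/(_ _ e'0) := cvg_stat (stat_slack wb').
  by apply: filterS => n; rewrite ler_norml; lra.
have ev_beta : \forall n \near \oo,
    \sum_f `|Ex u (beta f u) - Ex (u_ n) (beta f (u_ n))| <= e'.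
  have d'0 : 0 < e' / (#|D|%:R + 1) by rewrite divr_gt0// ltr_wpDl.
  have : \forall n \near \oo, forall f,
      `|Ex u (beta f u) - Ex (u_ n) (beta f (u_ n))| <= e' / (#|D|%:R + 1).
    by apply: filter_forall => f; move/cvgrPdist_le : (cvg_stat (sbeta f)); exact.
  apply: filterS => n h; apply: le_trans (ler_sum _ (fun f _ => h f)) _.
  rewrite sumr_const -[X in X <= _]mulr_natl mulrCA; apply: ler_piMr; first exact: ltW.
  by rewrite ler_pdivrMr ?ltr_wpDl// mul1r lerDl.
near=> n.
have S1 : Ex (u_ n) (slack b (u_ n)) <= 2 * e' by near: n; exact: ev_slack slackb.
have S2 : Ex (u_ n) (slack beta (u_ n)) <= 2 * e' by near: n; exact: ev_slack slackbeta.
have S3 : \sum_f `|Ex u (beta f u) - Ex (u_ n) (beta f (u_ n))| <= e' by near: n.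
move=> X Y g /card_gt0P[x0 _] /card_gt0P[y0 _] g1.
have bbeta v f : bounded (beta f v) by exact: bounded_weight wbeta f v.
pose m f := Ex (u_ n) (beta f (u_ n)).
have m0 f : 0 <= m f by apply: Ex_ge0 => w; exact: beta0.
(* The reply averaged over the bump [f] in [u_ n]; a bump of mass zero receives an irrelevant
   default. *)
pose rho (t : nat -> Y -> R) f y := if m f == 0 then (y == y0)%:R else
  Ex (u_ n) (fun w => beta f (u_ n) w * t (signal (~~ i) w) y) / m f.
have bt (t : nat -> Y -> R) y : strategy t ->
    bounded (fun w : triple hK => t (signal (~~ i) w) y).
  by move=> ht; exists 1 => w; exact: strategy_norm_le.
have rhoE t f y : strategy t ->
    Ex (u_ n) (fun w => beta f (u_ n) w * t (signal (~~ i) w) y) = m f * rho t f y.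
  move=> ht; rewrite /rho; case: eqP => [mf0|/eqP mf0]; last by rewrite mulrC divfK.
  rewrite mf0 mul0r; apply/le_anti/andP; split.
    rewrite -[leRHS]mf0; apply: Ex_le => //; first by apply: boundedM => //; exact: bt.
    by move=> w; rewrite ler_piMr// dist_le1.
  by apply: Ex_ge0 => w; rewrite mulr_ge0//; case: (ht (signal (~~ i) w)).
have rho_dist t f : strategy t -> dist (rho t f).
  move=> ht; rewrite /rho; case: eqP => [_|/eqP mf0]; first exact: dist_point.
  split=> [y|].
    rewrite divr_ge0//; apply: Ex_ge0 => w; rewrite mulr_ge0//.
    by case: (ht (signal (~~ i) w)).
  rewrite -mulr_suml -Ex_sum => [|y]; last by apply: boundedM => //; exact: bt.
  rewrite (_ : Ex _ _ = m f) ?divff//; apply: eq_Ex => w.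
  by rewrite -mulr_sumr; case: (ht (signal (~~ i) w)) => _ ->; rewrite mulr1.
pose sbar (s : nat -> X -> R) a := class_average i s (r a).
(* Class averages come from [u] and are played with bumps of [u_ n]; averaged replies come from
   [u_ n] and are played with bumps of [u]. *)
pose F s := mix x0 b (sbar s) (u_ n).
pose H t := mix y0 beta (rho t) u.
have sbar_dist s a : strategy s -> dist (sbar s a) by exact: class_average_dist.
have hH t : strategy t -> strategy (H t).
  by move=> ht; apply: (mix_strategy wbeta) => f; exact: rho_dist.
exists F, H; split=> // [s hs|s t hs ht].
  by apply: (mix_strategy wb) => a; exact: sbar_dist.
have hHt := hH t ht; have ds a := sbar_dist s a hs.
have hc v f p w : beta f v w * `|joint_belief i b p v w - c f p| <= d * beta f v w.
  exact: betaq.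
pose gam f y := forecast g (sbar s) c f y.
have gam1 f y : `|gam f y| <= 1.
  rewrite /gam /forecast (le_trans (norm_sum_le _ (fun p => reply_le1 g1 ds p y)))//.
    by move=> p; exact: joint_belief_ge0 wb p u _.
  by rewrite mulr1 (joint_belief_sum wb).
(* The reply [H t] is built from the opponent's statistics, as [ipay_average] requires. *)
have E1 : ipay u i g s (H t) = ipay u i g (fun c => class_average i s (rep u i c)) (H t).
  pose T y : process := fun v w =>
    \sum_f beta f v w * rho t f y + slack beta v w * (y == y0)%:R.
  apply: (@ipay_average _ _ _ _ _ _ T) => // y.
    apply: stat_add.
      apply: stat_sum => f; have := stat_scale (rho t f y) (sbeta f); congr stat.
      by apply/funext => v; apply/funext => w; rewrite mulrC.
    have := stat_scale (y == y0)%:R (stat_slack wbeta); congr stat.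
    by apply/funext => v; apply/funext => w; rewrite mulrC.
  by move=> w; rewrite /H (mixE wbeta).
have hav : strategy (fun c => class_average i s (rep u i c)).
  by move=> k; exact: class_average_dist.
have hmix : strategy (mix x0 b (sbar s) u) by exact: (mix_strategy wb).
(* At a signal of a listed class, the bump of that class is 1 and the others are 0, so the two
   strategies coincide there. *)
have E2 : `|ipay u i g (fun c => class_average i s (rep u i c)) (H t) -
    ipay u i g (mix x0 b (sbar s) u) (H t)| <= 2 * e'.
  have b1' := pair_bounded i hav hHt g1; have b2' := pair_bounded i hmix hHt g1.
  rewrite -ExB//; apply: le_trans (_ : Ex u (fun w => 2 * ind [set w | forall a, r a <>
      rep u i (signal i w)] w) <= _); last by rewrite ExZ ?ler_pM2l//; exact: bounded_ind.
  apply: Ex_norm_le; first exact: boundedB.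
    by apply: boundedM; [exact: bounded_cst|exact: bounded_ind].
  move=> w; rewrite indE; have [_|] := boolP (_ \in _).
    rewrite mulr1 (le_trans (ler_normB _ _))// (_ : 2 = 1 + 1)// lerD//.
      by apply: pair_norm_le.
    by apply: pair_norm_le.
  rewrite notin_setE /= => /existsNP[a /contrapT ra].
  rewrite mulr0 -sumrB big1 ?normr0// => x _; rewrite -sumrB big1// => y _.
  rewrite -mulrBl -mulrBl (mixE wb) (_ : _ - _ = 0) ?mul0r//.
  rewrite (stat_rep u w (stat_slack wb)) -ra /slack.
  have bw a' : b a' u w = (a' == a)%:R by rewrite (stat_rep u w (sb a')) -ra bE.
  have sum1 (G : A -> R) : \sum_a' (a' == a)%:R * G a' = G a.
    by rewrite (bigD1 a)//= eqxx mul1r big1 ?addr0// => a' /negPf ->; rewrite mul0r.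
  under eq_bigr do rewrite bw; rewrite sum1.
  under eq_bigr do rewrite bE -[(_ == _)%:R]mulr1; rewrite sum1.
  by rewrite subrr mul0r addr0 subrr.
have E3 := mix_approx x0 wb wbeta g1 ds (hc u) (ltW d0) hHt.
have E7 := mix_approx x0 wb wbeta g1 ds (hc (u_ n)) (ltW d0) ht.
have E6 : \sum_f \sum_y Ex (u_ n) (fun w => beta f (u_ n) w * t (signal (~~ i) w) y)
    * gam f y = \sum_f m f * \sum_y rho t f y * gam f y.
  apply: eq_bigr => f _; rewrite mulr_sumr; apply: eq_bigr => y _.
  by rewrite rhoE// mulrA.
have Gam1 f : `|\sum_y rho t f y * gam f y| <= 1 by apply: dist_norm_le => //; exact: rho_dist.
have E5 : `|\sum_f Ex u (beta f u) * (\sum_y rho t f y * gam f y)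
    - \sum_f m f * \sum_y rho t f y * gam f y| <= e'.
  rewrite -sumrB; apply: le_trans S3.
  rewrite (le_trans (ler_norm_sum _ _ _))//; apply: ler_sum => f _.
  by rewrite -mulrBl normrM ler_piMr.
(* On the listed class [f], the reply [H t] is exactly [rho t f]; only signals outside the listed
   classes contribute. *)
have E4 : `|\sum_f \sum_y Ex u (fun w => beta f u w * H t (signal (~~ i) w) y) * gam f y
    - \sum_f Ex u (beta f u) * (\sum_y rho t f y * gam f y)| <= 2 * e'.
  have bH y := bt (H t) y hHt.
  have -> : \sum_f \sum_y Ex u (fun w => beta f u w * H t (signal (~~ i) w) y) * gam f y =
      Ex u (fun w => \sum_f beta f u w * \sum_y H t (signal (~~ i) w) y * gam f y).
    rewrite Ex_sum => [|f]; last first.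
      apply: boundedM => //; apply: bounded_sum => y.
      by apply: boundedM => //; exact: bounded_cst.
    apply: eq_bigr => f _.
    under [RHS]eq_Ex do rewrite mulr_sumr; rewrite Ex_sum => [|y]; last first.
      by apply: boundedM => //; apply: boundedM => //; exact: bounded_cst.
    apply: eq_bigr => y _; rewrite mulrC -ExZ; last exact: boundedM.
    by apply: eq_Ex => w; ring.
  have -> : \sum_f Ex u (beta f u) * (\sum_y rho t f y * gam f y) =
      Ex u (fun w => \sum_f beta f u w * \sum_y rho t f y * gam f y).
    rewrite Ex_sum => [|f]; last by apply: boundedM => //; exact: bounded_cst.
    apply: eq_bigr => f _; rewrite mulrC -ExZ//.
    by apply: eq_Ex => w; rewrite mulrC.
  have bS1 : bounded (fun w => \sum_f beta f u w * \sum_y H t (signal (~~ i) w) y * gam f y).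
    apply: bounded_sum => f; apply: boundedM => //; apply: bounded_sum => y.
    by apply: boundedM => //; exact: bounded_cst.
  have bS2 : bounded (fun w => \sum_f beta f u w * \sum_y rho t f y * gam f y).
    by apply: bounded_sum => f; apply: boundedM => //; exact: bounded_cst.
  rewrite -ExB//; apply: le_trans (_ : Ex u (fun w => 2 * ind [set w | forall f, q f <>
      rep u (~~ i) (signal (~~ i) w)] w) <= _); last first.
    by rewrite ExZ ?ler_pM2l//; exact: bounded_ind.
  apply: Ex_norm_le; first exact: boundedB.
    by apply: boundedM; [exact: bounded_cst|exact: bounded_ind].
  move=> w; rewrite indE; have [_|] := boolP (_ \in _).
    have le1 (z : D -> R) : (forall f, `|z f| <= 1) -> `|\sum_f beta f u w * z f| <= 1.
      move=> z1; rewrite (le_trans (norm_sum_le _ z1))// mulr1; exact: beta1.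
    rewrite mulr1 (le_trans (ler_normB _ _))// (_ : 2 = 1 + 1)// lerD//; apply: le1 => // f.
    by apply: dist_norm_le => //; exact: hHt.
  rewrite notin_setE /= => /existsNP[f0 /contrapT qf].
  have bw f : beta f u w = (f == f0)%:R by rewrite (stat_rep u w (sbeta f)) -qf betaE.
  have sum1 (G : D -> R) : \sum_f (f == f0)%:R * G f = G f0.
    by rewrite (bigD1 f0)//= eqxx mul1r big1 ?addr0// => f' /negPf ->; rewrite mul0r.
  rewrite mulr0; under eq_bigr do rewrite bw; under [X in _ - X]eq_bigr do rewrite bw.
  rewrite !sum1 -sumrB big1 ?normr0// => y _; rewrite -mulrBl.
  rewrite /H (mixE wbeta) (stat_rep u w (stat_slack wbeta)) -qf /slack.
  under eq_bigr do rewrite bw; rewrite sum1.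
  under eq_bigr do rewrite betaE -[(_ == _)%:R]mulr1; rewrite sum1.
  by rewrite subrr mul0r addr0 subrr mul0r.
have ee : e = 13 * e' by rewrite /e' mulrC divfK.
rewrite E1; move: E2 E3 E4 E5 E7 S1 S2 (slackb) (slackbeta) (dN).
rewrite -/(F s) -[X in ipay (u_ n) i g (F s) t - X]/(\sum_f \sum_y Ex (u_ n)
  (fun w => beta f (u_ n) w * t (signal (~~ i) w) y) * gam f y) E6.
rewrite -[X in ipay u i g (mix x0 b (sbar s) u) (H t) - X]/(\sum_f \sum_y
  Ex u (fun w => beta f u w * H t (signal (~~ i) w) y) * gam f y).
set a1 := ipay u i g _ _; set a2 := ipay u i g _ _; set a3 := \sum_f \sum_y _.
set a4 := \sum_f _; set a5 := \sum_f _; set a6 := ipay (u_ n) i g _ _.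
set k1 := Ex u _; set k2 := Ex u _; set k3 := Ex _ _; set k4 := Ex _ _.
rewrite !ler_norml ee; move: e'0; move: (#|_|%:R * d) => z.
clearbody a1 a2 a3 a4 a5 a6 k1 k2 k3 k4 e'; lra.
Unshelve. all: by end_near. Qed.

(** The transfer for the maximizer bounds the value of [u] by that of [u_ n]. The transfer for the
    minimizer gives the reverse: its [H] carries maximizing strategies from [u_ n] to [u], and its
    [F] carries the replies back. *)
Lemma cvg_stat_vdist : vdist (u_ n) u @[n --> \oo] --> (0 : R).
Proof.
apply/cvgrPdist_le => e e0; near=> n.
have T1 : forall (X Y : finType) (g : K -> X -> Y -> R), (0 < #|X|)%N -> (0 < #|Y|)%N ->
    (forall k x y, `|g k x y| <= 1) -> exists F H,
    [/\ forall s, strategy s -> strategy (F s), forall t, strategy t -> strategy (H t) &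
      forall s t, strategy s -> strategy t ->
        `|ipay u true g s (H t) - ipay (u_ n) true g (F s) t| <= e].
  by near: n; exact: transfer.
have T2 : forall (X Y : finType) (g : K -> X -> Y -> R), (0 < #|X|)%N -> (0 < #|Y|)%N ->
    (forall k x y, `|g k x y| <= 1) -> exists F H,
    [/\ forall s, strategy s -> strategy (F s), forall t, strategy t -> strategy (H t) &
      forall s t, strategy s -> strategy t ->
        `|ipay u false g s (H t) - ipay (u_ n) false g (F s) t| <= e].
  by near: n; exact: transfer.
have close (I J : finType) (g : K -> I -> J -> R) : (0 < #|I|)%N -> (0 < #|J|)%N ->
    (forall k i j, -1 <= g k i j <= 1) -> `|game_val (u_ n) g - game_val u g| <= e.
  move=> I0 J0 g1.
  have g1' k i j : `|g k i j| <= 1 by rewrite ler_norml.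
  have payB P s t : strategy s -> strategy t -> `|gpay P (fun w => g w.1.1) s t| <= 1.
    by move=> hs ht; exact: gpay_norm_le.
  have le1 : 1 * game_val u g - e <= game_val (u_ n) g.
    have [F [H [hF hH FH]]] := T1 I J g I0 J0 g1'.
    apply: (@maxmin_le _ _ _ _ _ _ _ _ _ (gpay u (fun w => g w.1.1))
      (gpay (u_ n) (fun w => g w.1.1)) 1) => //; try exact: strategy_nonempty.
    - by move=> s t; exact: payB.
    - by move=> s t; exact: payB.
    - move=> s hs; exists (F s); first exact: hF.
      move=> t ht; exists (H t); first exact: hH.
      by have := FH s t hs ht; rewrite ler_norml mul1r -![ipay _ true _ _ _]/(gpay _ _ _ _); lra.
  have le2 : 1 * game_val (u_ n) g - e <= game_val u g.
    have [F [H [hF hH FH]]] := T2 J I (fun k j i => g k i j) J0 I0 (fun k j i => g1' k i j).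
    apply: (@maxmin_le _ _ _ _ _ _ _ _ _ (gpay (u_ n) (fun w => g w.1.1))
      (gpay u (fun w => g w.1.1)) 1) => //; try exact: strategy_nonempty.
    - by move=> s t; exact: payB.
    - by move=> s t; exact: payB.
    - move=> s hs; exists (H s); first exact: hH.
      move=> t ht; exists (F t); first exact: hF.
      by have := FH t s ht hs; rewrite !gpay_swap ler_norml; lra.
  by rewrite ler_norml; lra.
rewrite sub0r normrN; apply: sup_norm_le.
  exists `|game_val (u_ n) (fun _ (_ _ : unit) => 0) - game_val u (fun _ (_ _ : unit) => 0)|.
  exists unit, unit, (fun _ _ _ => 0); rewrite card_unit; split=> // _ _ _.
  by rewrite ler01 lerN10.
by move=> _ [I [J [g [I0 J0 g1 ->]]]]; rewrite normr_id; exact: close.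
Unshelve. all: by end_near. Qed.

End Convergence.

Theorem theorem3 (R : realType) (K : finType) (hK : (1 < #|K|)%N)
    (u : info R hK) (u_ : nat -> info R hK) :
  (vdist (u_ n) u @[n --> \oo] --> (0 : R)) <->
  (mz (u_ n) @[n --> \oo] --> mz u).
Proof.
split=> [cvg_vdist|cvg_mz].
  by apply: cvg_stat_mz => X sX; exact: cvg_vdist_stat sX.
by apply: cvg_stat_vdist => b o X sX; exact: cvg_mz_stat sX.
Qed.
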